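(* Let $G_1$ and $G_2$ be finite graphs, neither of which has a universal vertex. If the Bell colouring graphs $\mathcal{B}(G_1)$ and $\mathcal{B}(G_2)$ are isomorphic, then $G_1\cong G_2$. (That is, a graph with no universal vertices is uniquely determined by its Bell colouring graph.)
   Context: All graphs are finite and simple. A vertex of a graph $G$ is universal if it has degree $|V(G)|-1$. An independent set partition of $G$ is a partition of $V(G)$ into nonempty independent sets (called parts). For an independent set partition $P$ and $v\in V(G)$, let $P-v$ denote the partition of $V(G)\setminus\{v\}$ obtained by deleting $v$ from its part (discarding that part if it becomes empty). The Bell colouring graph $\mathcal{B}(G)$ has as vertex set the set of independent set partitions of $G$, and two partitions $P\neq Q$ are adjacent if and only if $P-v=Q-v$ for some $v\in V(G)$ (i.e. one is obtained from the other by changing the part of a single vertex, either moving it into another existing part or into a new part of size $1$). *)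

(* Defs.v *)
From HB Require Import structures.
From mathcomp Require Import all_boot.

Set Implicit Arguments.
Unset Strict Implicit.
Unset Printing Implicit Defensive.

Record sgraph := SGraph {
  vertex :> finType;
  edge : rel vertex;
  edge_sym : symmetric edge;
  edge_irr : irreflexive edge
}.

Definition degree (G : sgraph) (v : G) : nat := #|[set w | edge v w]|.

Definition universal (G : sgraph) (v : G) : bool := degree v == #|G| - 1.

Definition isomorphic (G H : sgraph) : Prop :=
  exists f : G -> H,
    bijective f /\ forall x y : G, edge (f x) (f y) = edge x y.

Definition independent (G : sgraph) (A : {set G}) : bool :=
  [forall x in A, forall y in A, ~~ edge x y].

(* MathComp's [partition] already requires the parts to be nonempty. *)
Definition is_isp (G : sgraph) (P : {set {set G}}) : bool :=
  partition P [set: G] && [forall A in P, independent A].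

Definition isp (G : sgraph) : finType :=
  {P : {set {set G}} | is_isp P}.

(* The partition P - v of V(G) \ {v}. *)
Definition del_vertex (G : sgraph) (P : {set {set G}}) (v : G) :
    {set {set G}} :=
  [set A :\ v | A in P] :\ set0.

Definition bell_edge (G : sgraph) : rel (isp G) := fun P Q =>
  (P != Q) && [exists v : G, del_vertex (val P) v == del_vertex (val Q) v].

Lemma bell_edge_sym (G : sgraph) : symmetric (@bell_edge G).
Proof.
move=> P Q; rewrite /bell_edge eq_sym; congr andb.
by apply: eq_existsb => v; rewrite eq_sym.
Qed.

Lemma bell_edge_irr (G : sgraph) : irreflexive (@bell_edge G).
Proof. by move=> P; rewrite /bell_edge eqxx. Qed.

Definition bell_graph (G : sgraph) : sgraph :=
  SGraph (@bell_edge_sym G) (@bell_edge_irr G).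

(* Main.v *)
(** Let H be the complement of G. A partition is a vertex of B(G) exactly when
its "same part" relation is contained in H, and two partitions are adjacent
exactly when these relations agree away from one vertex. The neighbours of the
discrete partition D are the merges of a single edge of H, so B(G) induces on
them the line graph of H; three pairwise adjacent merges come from a triangle,
and not from a star, exactly when they have a common neighbour at distance two
from D. Hence the stars of the vertices of H are recovered from (B(G), D) as
families of neighbours of D, and they determine H since it has no isolated
vertex.

An isomorphism f : B(G1) -> B(G2) need not map D1 to D2. But P = f(D1)
inherits three properties of common neighbours at distance two, and these force
every part A of P with at least two vertices to be either a triangle component
of H or the pair of centres of a double star component. In both cases
exchanging the part A with the singletons of A is an automorphism of B(G2).
Composing f with it makes P finer, so after finitely many steps f(D1) = D2. *)

Require Import Defs.
From HB Require Import structures.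
From mathcomp Require Import all_boot.

Set Implicit Arguments.
Unset Strict Implicit.
Unset Printing Implicit Defensive.

Lemma negPfC (T : eqType) (x y : T) : x != y -> (y == x) = false.
Proof. by rewrite eq_sym => /negPf. Qed.

(** * Independent set partitions as equivalence relations contained in the complement *)

Section Bell.

Variable G : sgraph.
Implicit Types (P Q R : isp G) (u v w x y z : G) (r : rel G).

Definition nonedge x y := (x != y) && ~~ edge x y.

Lemma nonedge_sym x y : nonedge x y = nonedge y x.
Proof. by rewrite /nonedge eq_sym edge_sym. Qed.

Lemma nonedgeE x y : edge x y = (x != y) && ~~ nonedge x y.
Proof.
by rewrite /nonedge; case: eqP => [->|_] /=; rewrite ?edge_irr ?negbK.
Qed.

Definition sim P : rel G := fun x y => y \in pblock (val P) x.

Lemma isp_partition P : partition (val P) [set: G].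
Proof. by case/andP: (valP P). Qed.

Lemma isp_cover P x : x \in cover (val P).
Proof. by have /and3P[/eqP-> _ _] := isp_partition P; rewrite inE. Qed.

Lemma isp_triv P : trivIset (val P).
Proof. by have /and3P[] := isp_partition P. Qed.

Lemma sim_refl P x : sim P x x.
Proof. by rewrite /sim mem_pblock isp_cover. Qed.

Lemma simE P x y : sim P x y = (pblock (val P) x == pblock (val P) y).
Proof. by rewrite eq_pblock ?isp_triv ?isp_cover. Qed.

Lemma sim_sym P x y : sim P x y = sim P y x.
Proof. by rewrite !simE eq_sym. Qed.

Lemma sim_transr P x y z : sim P x y -> sim P x z = sim P y z.
Proof. by rewrite !simE => /eqP->. Qed.

Lemma sim_trans P y x z : sim P x y -> sim P y z -> sim P x z.
Proof. by move=> /sim_transr->. Qed.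

Lemma sim_block P x y A : A \in val P -> x \in A -> sim P x y = (y \in A).
Proof. by move=> PA Ax; rewrite /sim (def_pblock (isp_triv P) PA Ax). Qed.

Lemma sim_nonedge P x y : sim P x y -> x != y -> nonedge x y.
Proof.
rewrite /nonedge => sxy -> /=; have /andP[_ /forall_inP indP] := valP P.
have PA: pblock (val P) x \in val P by rewrite pblock_mem ?isp_cover.
have /forall_inP indA := indP _ PA.
by have /forall_inP := indA x (sim_refl P x); apply.
Qed.

Lemma sim_inj P Q : sim P =2 sim Q -> P = Q.
Proof.
move=> eqPQ; apply/val_inj.
rewrite -(equivalence_partition_pblock (isp_partition P)).
rewrite -(equivalence_partition_pblock (isp_partition Q)).
apply: eq_imset => x; apply/setP=> y; rewrite !inE; exact: eqPQ.
Qed.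

Definition valid r :=
  [/\ reflexive r, symmetric r, transitive r
    & forall x y, r x y -> x != y -> nonedge x y].

Lemma valid_isp r : valid r -> is_isp (equivalence_partition r [set: G]).
Proof.
case=> rr rs rt rn.
have eqr: {in [set: G] & &, equivalence_rel r}.
  by apply: in3W => x y z; split=> // rxy; apply: (left_trans rs rt).
rewrite /is_isp equivalence_partitionP //=.
apply/forall_inP=> A /imsetP[x _ ->].
apply/forall_inP=> y; rewrite !inE => rxy.
apply/forall_inP=> z; rewrite !inE => rxz.
have ryz: r y z by apply: rt rxz; rewrite rs.
have [->|/(rn _ _ ryz)/andP[]//] := eqVneq y z.
by rewrite edge_irr.
Qed.

Lemma valid_eq : valid (fun x y => x == y).
Proof.
split=> [x|x y|y x z /eqP->|x y /eqP->] //.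
by rewrite eqxx.
Qed.

Definition discrete : isp G :=
  exist (fun p => is_isp p) _ (valid_isp valid_eq).

(** Total in [r]: an invalid relation yields the default [discrete], so validity is asked for only
    where [sim_mk] is applied. The lock stops simplification from unfolding the partition. *)
Definition mkisp r : isp G :=
  locked (insubd discrete (equivalence_partition r [set: G])).

Lemma sim_mk r : valid r -> sim (mkisp r) =2 r.
Proof.
move=> vr x y; rewrite /sim /mkisp -lock insubdK; last exact: valid_isp.
case: vr => rr rs rt rn.
apply: pblock_equivalence_partition; rewrite ?inE //.
by apply: in3W => a b c; split=> // rab; apply: (left_trans rs rt).
Qed.

Lemma sim_discrete x y : sim discrete x y = (x == y).
Proof.
rewrite /sim /=; apply: pblock_equivalence_partition; rewrite ?inE //.
by apply: in3W => a b c; split=> // /eqP->.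
Qed.

(** * Adjacency in the Bell colouring graph *)

(** The relational form of P - v = Q - v. For fixed [v] it is an equivalence, so changes at the same
    vertex can be chained through a third partition. *)
Definition agree v P Q := forall x y, x != v -> y != v -> sim P x y = sim Q x y.

Lemma agree_refl v P : agree v P P. Proof. by []. Qed.

Lemma agree_sym v P Q : agree v P Q -> agree v Q P.
Proof. by move=> aPQ x y xv yv; rewrite aPQ. Qed.

Lemma agree_trans v P Q R : agree v P Q -> agree v Q R -> agree v P R.
Proof. by move=> aPQ aQR x y xv yv; rewrite aPQ ?aQR. Qed.

(** A part of P - v is nonempty, so it contains some [x] other than [v]; off [v] it coincides with
    the part of [x] in [Q]. *)
Lemma del_vertex_sub P Q v : agree v P Q ->
  del_vertex (val P) v \subset del_vertex (val Q) v.
Proof.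
move=> aPQ; apply/subsetP=> B; rewrite !inE => /andP[B0 /imsetP[A PA defB]].
rewrite B0; have /set0Pn[x] := B0; rewrite defB !inE => /andP[xv Ax].
apply/imsetP; exists (pblock (val Q) x); first by rewrite pblock_mem ?isp_cover.
apply/setP=> y; rewrite !inE; case: (eqVneq y v) => //= yv.
by rewrite -(sim_block y PA Ax) aPQ.
Qed.

Lemma del_vertexP P Q v :
  reflect (agree v P Q) (del_vertex (val P) v == del_vertex (val Q) v).
Proof.
apply: (iffP eqP) => [eqd|aPQ]; last first.
  by apply/eqP; rewrite eqEsubset !del_vertex_sub //; apply: agree_sym.
have sub R S x y : del_vertex (val R) v = del_vertex (val S) v ->
    x != v -> y != v -> sim R x y -> sim S x y.
  move=> eqRS xv yv sxy; set A := pblock (val R) x.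
  have : A :\ v \in del_vertex (val R) v.
    rewrite !inE; apply/andP; split; last first.
      by apply: imset_f; rewrite pblock_mem ?isp_cover.
    by apply/set0Pn; exists x; rewrite !inE xv; apply: sim_refl.
  rewrite eqRS !inE => /andP[_ /imsetP[B SB eqAB]].
  have Bx: x \in B.
    have : x \in A :\ v by rewrite !inE xv; apply: sim_refl.
    by rewrite eqAB !inE => /andP[].
  rewrite (sim_block _ SB Bx).
  have : y \in A :\ v by rewrite !inE yv; apply: sxy.
  by rewrite eqAB !inE => /andP[].
by move=> x y xv yv; apply/idP/idP; apply: sub.
Qed.

Lemma bellP P Q : reflect (P <> Q /\ exists v, agree v P Q) (bell_edge P Q).
Proof.
apply: (iffP andP) => [[/eqP nPQ /existsP[v /del_vertexP aPQ]]|[nPQ [v aPQ]]].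
  by split=> //; exists v.
by split; [apply/eqP | apply/existsP; exists v; apply/del_vertexP].
Qed.

Lemma bell_edgeI v P Q x y :
  agree v P Q -> sim P x y != sim Q x y -> bell_edge P Q.
Proof.
move=> aPQ dPQ; apply/bellP; split; last by exists v.
by move=> eqPQ; rewrite eqPQ eqxx in dPQ.
Qed.

(** The moved vertex lies in every pair on which the two relations differ, and no vertex lies in two
    disjoint pairs. Most refutations of adjacency below go this way. *)
Lemma bell_edgeF a b c d P Q :
  sim P a b != sim Q a b -> sim P c d != sim Q c d ->
  [&& a != c, a != d, b != c & b != d] -> bell_edge P Q = false.
Proof.
move=> dab dcd /and4P[ac ad bc bd]; apply/negP=> /bellP[_ [v aPQ]].
have: (a == v) || (b == v).
  by apply: contraNT dab; rewrite negb_or => /andP[av bv]; rewrite aPQ.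
have: (c == v) || (d == v).
  by apply: contraNT dcd; rewrite negb_or => /andP[cv dv]; rewrite aPQ.
case/orP=> /eqP<-; case/orP=> /eqP eqv.
- by rewrite eqv eqxx in ac.
- by rewrite eqv eqxx in bc.
- by rewrite eqv eqxx in ad.
by rewrite eqv eqxx in bd.
Qed.

Lemma agree_eq v P Q :
  agree v P Q -> (forall y, y != v -> sim P v y = sim Q v y) -> P = Q.
Proof.
move=> aPQ eqv; apply: sim_inj => x y.
have [->|xv] := eqVneq x v; have [->|yv] := eqVneq y v.
- by rewrite !sim_refl.
- exact: eqv.
- by rewrite sim_sym [RHS]sim_sym eqv.
exact: aPQ.
Qed.

(** * Moving one vertex *)

Definition isol P v := mkisp (fun x y => (x == y) || [&& x != v, y != v & sim P x y]).

Lemma sim_isol P v x y :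
  sim (isol P v) x y = (x == y) || [&& x != v, y != v & sim P x y].
Proof.
rewrite sim_mk //; split=> [a|a b|b a c|a b].
- by rewrite eqxx.
- by rewrite eq_sym sim_sym; congr orb; rewrite andbCA.
- case/predU1P=> [->//|/and3P[av bv sab]] /predU1P[<-|/and3P[_ cv sbc]].
    by rewrite av bv sab orbT.
  by rewrite av cv (sim_trans sab sbc) orbT.
case/predU1P=> [->|/and3P[_ _ sab]]; first by rewrite eqxx.
exact: sim_nonedge sab.
Qed.

Lemma agree_isol P v : agree v (isol P v) P.
Proof.
by move=> x y xv yv; rewrite sim_isol xv yv; case: eqP => // ->; rewrite sim_refl.
Qed.

Lemma sim_isol_self P v y : sim (isol P v) v y = (v == y).
Proof. by rewrite sim_isol eqxx orbF. Qed.

Definition movable P v w := forall y, y != v -> sim P w y -> nonedge v y.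

(** Pulling [sim P] back along the map that sends [v] to [w] and fixes the rest gives an equivalence
    at once; [movable] supplies independence. *)
Definition move P v w :=
  let f x := if x == v then w else x in mkisp (fun x y => sim P (f x) (f y)).

Lemma sim_move P v w x y : movable P v w ->
  sim (move P v w) x y =
  sim P (if x == v then w else x) (if y == v then w else y).
Proof.
move=> mv; rewrite sim_mk //; split=> [a|a b|b a c|a b].
- exact: sim_refl.
- exact: sim_sym.
- exact: sim_trans.
case: (eqVneq a v) => [->|av]; case: (eqVneq b v) => [->|bv].
- by [].  
- by move=> swb _; apply: mv.
- by move=> saw _; rewrite nonedge_sym mv // sim_sym.
exact: sim_nonedge.
Qed.

Lemma agree_move P v w : movable P v w -> agree v (move P v w) P.
Proof. by move=> mv x y /negPf xv /negPf yv; rewrite sim_move // xv yv. Qed.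

Lemma sim_move_self P v w y : movable P v w -> y != v ->
  sim (move P v w) v y = sim P w y.
Proof. by move=> mv /negPf yv; rewrite sim_move // eqxx yv. Qed.

Lemma isol_mono P Q u v : u != v -> agree u P Q -> agree u (isol P v) (isol Q v).
Proof. by move=> uv aPQ x y xu yu; rewrite !sim_isol aPQ. Qed.

Lemma move_mono P Q u v w : u != w -> movable P v w -> movable Q v w ->
  agree u P Q -> agree u (move P v w) (move Q v w).
Proof.
move=> uw mP mQ aPQ x y xu yu; rewrite !sim_move // aPQ //.
  by case: ifP => // _; rewrite eq_sym.
by case: ifP => // _; rewrite eq_sym.
Qed.

Definition single P v := forall y, sim P v y = (v == y).

Lemma movable_single P v w : single P w -> nonedge v w -> movable P v w.
Proof. by move=> sw nvw y _; rewrite sw => /eqP<-. Qed.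

Lemma agree_single v P Q : agree v P Q -> single P v -> single Q v -> P = Q.
Proof. by move=> aPQ sP sQ; apply: (agree_eq aPQ) => y _; rewrite sP sQ. Qed.

Lemma single_isol P v : single (isol P v) v.
Proof. by move=> y; rewrite sim_isol_self. Qed.

Lemma single_or P v : single P v \/ exists2 y, y != v & sim P v y.
Proof.
case: (pickP [pred y | (y != v) && sim P v y]) => [y /andP[yv svy]|no].
  by right; exists y.
left=> y; have := no y => /=.
by have [->|/=] := eqVneq y v; rewrite ?sim_refl ?eqxx // eq_sym => /negPf-> ->.
Qed.

End Bell.
(** * Local structure at a vertex of the Bell colouring graph *)

Section Local.

Variable B : sgraph.
Implicit Types p q e f g h : B.

(* For [q] connected to [p] by a path of length two, [far p q] says that [q] is
   at distance exactly two. *)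
Definition far p q := (q != p) && ~~ edge p q.

Definition joins p q e f := [&& far p q, edge q e & edge q f].

Definition join_unique p := forall e f q q', e != f ->
  edge p e -> edge p f -> joins p q e f -> joins p q' e f -> q = q'.

Definition join_clique p := forall e f g q, e != g ->
  edge p e -> edge p f -> edge p g ->
  joins p q e f -> edge q g -> edge e f -> edge e g.

Definition join_exists p := forall e f, e != f ->
  edge p e -> edge p f -> ~~ edge e f -> exists q, joins p q e f.

(** Phrased by adjacency alone, hence transported by isomorphisms. At the discrete partition, a far
    common neighbour of two merges has either a triangle or two disjoint pairs as its nontrivial
    parts, which explains the three clauses. *)
Definition locally_discrete p :=
  [/\ join_unique p, join_clique p & join_exists p].

End Local.

(** * The neighbourhood of the discrete partition and its three local properties *)

Section Discrete.

Variable G : sgraph.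
Implicit Types (P Q e f g q : bell_graph G) (a b c d u v w x y z : G).

Local Notation D := (discrete G : bell_graph G).

Lemma single_discrete v : single D v.
Proof. by move=> y; rewrite sim_discrete. Qed.

Definition merged a b : bell_graph G := move D a b.

Lemma movable_discrete a b : nonedge a b -> movable D a b.
Proof. by apply: movable_single; apply: single_discrete. Qed.

Lemma sim_merge a b x y : nonedge a b ->
  sim (merged a b) x y = [|| x == y, (x == a) && (y == b) | (x == b) && (y == a)].
Proof.
move=> nab; rewrite sim_move ?sim_discrete; last exact: movable_discrete.
have /andP[/negPf ab _] := nab.
have [->|xa] := eqVneq x a; have [->|ya] := eqVneq y a => //=.
- exact: eqxx.
- by rewrite andbF orbF eq_sym.
- by rewrite (negPf xa) andbT.
by rewrite andbF orbF.
Qed.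

Lemma agree_merge a b : nonedge a b -> agree a (merged a b) D.
Proof. by move/movable_discrete/agree_move. Qed.

Lemma mergeC a b : nonedge a b -> merged a b = merged b a.
Proof.
move=> nab; apply: sim_inj => x y.
by rewrite !sim_merge // 1?nonedge_sym // [X in _ || X]orbC.
Qed.

Lemma merge_sim a b : nonedge a b -> sim (merged a b) a b.
Proof. by move=> nab; rewrite sim_merge // !eqxx orbT. Qed.

Lemma edge_merge a b : nonedge a b -> edge D (merged a b).
Proof.
move=> nab; apply: (@bell_edgeI _ a _ _ a b).
  by apply: agree_sym; apply: agree_merge.
by rewrite merge_sim // sim_discrete; case/andP: nab => /negPf->.
Qed.

(** If the moved vertex were alone in [e], then [e] would be discrete. So it joins some [y], and
    nothing else is united. *)
Lemma neighbor_discrete e : edge D e -> exists a b, nonedge a b /\ e = merged a b.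
Proof.
case/bellP=> neD [v aDe].
have [sev|[y yv svy]] := single_or e v.
  by case: neD; apply/(agree_single aDe _ sev)/single_discrete.
have nvy: nonedge v y by apply: sim_nonedge svy _; rewrite eq_sym.
exists v, y; split=> //; apply: (@agree_eq _ v).
  by apply: agree_trans (agree_sym aDe) _; apply: agree_sym; apply: agree_merge.
move=> z zv; rewrite (sim_move_self (movable_discrete nvy)) // (sim_transr _ svy).
by rewrite aDe.
Qed.

Lemma merge_inj a b c d : nonedge a b -> nonedge c d ->
  sim (merged a b) c d -> merged a b = merged c d.
Proof.
move=> nab ncd; rewrite sim_merge //; have /andP[/negPf-> _] := ncd.
case/orP=> //= /orP[]/andP[/eqP-> /eqP->] //; exact: mergeC.
Qed.

(** This is the line graph of the complement: disjoint edges give two disjoint pairs of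
    disagreement, whereas two edges with a common end are both discrete off that end. *)
Lemma merge_neighbor a b c d : nonedge a b -> nonedge c d ->
  edge (merged a b) (merged c d) =
    (merged a b != merged c d) && [|| a == c, a == d, b == c | b == d].
Proof.
move=> nab ncd; case: eqVneq => [->|nef] /=; first exact: bell_edge_irr.
have ab: a != b by case/andP: nab.
have cd: c != d by case/andP: ncd.
have dif: sim (merged a b) a b != sim (merged c d) a b.
  rewrite merge_sim //; apply: contra_neq nef => eqs.
  by apply/esym/merge_inj.
have dif2: sim (merged a b) c d != sim (merged c d) c d.
  rewrite merge_sim //; apply: contra_neq nef => eqs.
  by apply/merge_inj.
apply/idP/idP.
  apply: contraTT; rewrite !negb_or => ?.
  exact/negbT/(bell_edgeF dif dif2).
(* A merge is symmetric in its ends, so the shared vertex can be put first in each pair. *)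
wlog: a b c d nab ncd nef {ab cd dif dif2} / a == c.
  have ndc: nonedge d c by rewrite nonedge_sym.
  have nba: nonedge b a by rewrite nonedge_sym.
  move=> W; case/or4P=> h; first by apply: W => //; rewrite h.
  - by rewrite (mergeC ncd) in nef *; apply: W; rewrite ?h.
  - by rewrite (mergeC nab) in nef *; apply: W; rewrite ?h.
  by rewrite (mergeC nab) (mergeC ncd) in nef *; apply: W; rewrite ?h.
have dif: sim (merged a b) a b != sim (merged c d) a b.
  rewrite merge_sim //; apply: contra_neq nef => eqs.
  by apply/esym/merge_inj.
move=> /eqP eac _; subst c; apply: (bell_edgeI (v := a)) dif.
by apply: agree_trans (agree_merge nab) _; apply/agree_sym/agree_merge.
Qed.

(** Let [z] be the vertex moved between [q] and the merge. If [z] were [a] or [b], then [q] would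
    agree with [D] off [z], against [far]; if [z] were alone in [q], then [q] would be the merge
    itself. *)
Lemma far_neighbor q a b : far D q -> nonedge a b -> edge q (merged a b) ->
  sim q a b /\
  exists z, [/\ z != a, z != b, agree z q (merged a b) & ~ single q z].
Proof.
case/andP=> nqD /negP naD nab /bellP[nqe [z aqe]].
have near v : agree v q D -> False.
  move=> aqD; apply: naD; apply/bellP; split; last by exists v; apply: agree_sym.
  by move=> eqDq; rewrite -eqDq eqxx in nqD.
have za: z != a.
  apply/eqP=> eza; subst z.
  by apply: (near a); apply: agree_trans aqe (agree_merge nab).
have zb: z != b.
  apply/eqP=> ezb; subst z; apply: (near b); apply: agree_trans aqe _.
  by rewrite mergeC //; apply: agree_merge; rewrite nonedge_sym.
split; first by rewrite aqe ?merge_sim // eq_sym.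
exists z; split=> // sqz; apply: nqe; apply: agree_single aqe sqz _.
by move=> y; rewrite sim_merge // (negPf za) (negPf zb) !orbF.
Qed.

(** The vertex in which [q] and [merged a b] differ is an end of the second edge, since otherwise
    [c] and [d] would already be united in [merged a b]. The second edge is returned with this end
    first. *)
Lemma joins_through q a b c d : far D q -> nonedge a b -> nonedge c d ->
  merged a b != merged c d -> edge q (merged a b) -> edge q (merged c d) ->
  exists z w, [/\ merged c d = merged z w, nonedge z w, z != a & z != b] /\
    agree z q (merged a b).
Proof.
move=> fq nab ncd nef qe qf.
have [_ [z [za zb aqe _]]] := far_neighbor fq nab qe.
have [scd _] := far_neighbor fq ncd qf.
have [ezc|zc] := eqVneq z c; first by subst z; exists c, d.
have [ezd|zd] := eqVneq z d.
  subst z; exists d, c; split=> //; split=> //; first exact: mergeC.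
  by rewrite nonedge_sym.
have: sim q c d by [].
rewrite aqe 1?eq_sym // => /(merge_inj nab ncd) eqef.
by rewrite eqef eqxx in nef.
Qed.

Lemma join_unique_discrete : join_unique D.
Proof.
move=> e f q q' nef /neighbor_discrete[a [b [nab ee]]].
move=> /neighbor_discrete[c [d [ncd ef]]] /and3P[fq qe qf] /and3P[fq' qe' qf'].
subst e f.
have [z [w [[e1 nzw za zb] aqe]]] := joins_through fq nab ncd nef qe qf.
rewrite e1 in nef qf qf' *.
have [z' [w' [[e2 nzw' za' zb'] aqe']]] := joins_through fq' nab nzw nef qe' qf'.
have [szw _] := far_neighbor fq nzw qf.
have [szw' _] := far_neighbor fq' nzw qf'.
have zw: z != w by case/andP: nzw.
have wz: w != z by rewrite eq_sym.
have: sim (merged z w) z' w' by rewrite e2 merge_sim.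
rewrite sim_merge //; have /andP[/negPf-> _] := nzw'.
have me x y : x != a -> x != b -> sim (merged a b) x y = (x == y).
  by move=> /negPf xa /negPf xb; rewrite sim_merge // xa xb !orbF.
case/orP=> //= /orP[]/andP[/eqP ez /eqP ew]; subst z' w'.
  apply: (@agree_eq _ z); first by apply: agree_trans aqe (agree_sym aqe').
  move=> y yz; rewrite (sim_transr _ szw) (sim_transr _ szw').
  by rewrite aqe ?aqe'.
(* Here [q'] arises by moving the other end [w]. Then both [z] and [w] avoid [a] and [b], and both
   partitions have ab and zw as their nontrivial parts. *)
apply: (@agree_eq _ z) => [x y xz yz|y yz]; last first.
  rewrite (sim_transr _ szw) aqe // me //.
  have [->|yw] := eqVneq y w; first by rewrite szw'.
  by rewrite aqe' // me // (negPfC yz).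
wlog yw: x y xz yz / y != w.
  move=> W; have [eyw|yw] := eqVneq y w; last exact: W.
  have [->|xw] := eqVneq x w; first by rewrite eyw !sim_refl.
  by rewrite sim_sym [RHS]sim_sym W.
rewrite aqe //; have [->|xw] := eqVneq x w; last by rewrite aqe'.
by rewrite me // -(sim_transr _ szw') aqe' // me // (negPfC yw) (negPfC yz).
Qed.

(** Some end [z] of the second edge lies off the first edge ab, and [q] is [merged a b] with [z]
    moved. As these edges meet, [z] joins the part ab. A third merge distinct from the first has [z]
    as an end, and its other end lies in ab. *)
Lemma join_clique_discrete : join_clique D.
Proof.
move=> e f g q neg /neighbor_discrete[a [b [nab ee]]].
move=> /neighbor_discrete[c [d [ncd ef]]] /neighbor_discrete[k [l [nkl eg]]].
subst e f g; case/and3P=> fq qe qf qg.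
have [->|nef] := eqVneq (merged a b) (merged c d); first by rewrite [edge _ _]edge_irr.
have [z [w [[e1 nzw za zb] aqe]]] := joins_through fq nab ncd nef qe qf.
rewrite e1 in nef qf *; rewrite !merge_neighbor // neg nef /=.
rewrite (negPfC za) (negPfC zb) /= ![_ == w]eq_sym => wab.
have [szw _] := far_neighbor fq nzw qf.
have [skl _] := far_neighbor fq nkl qg.
have [sab _] := far_neighbor fq nab qe.
have zw: z != w by case/andP: nzw.
have eab x y : (x == a) || (x == b) ->
    sim (merged a b) x y -> (y == a) || (y == b).
  rewrite sim_merge // => xab; case/or3P=> [/eqP<- //||] /andP[_ ->] //.
  by rewrite orbT.
wlog zk : k l nkl neg qg skl / z == k.
  have nlk: nonedge l k by rewrite nonedge_sym.
  have swap := mergeC nkl.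
  move=> W; have [zk|zk] := eqVneq z k; first by apply: W; rewrite ?zk.
  have [zl|zl] := eqVneq z l.
    rewrite swap in neg qg; have := W l k nlk neg qg; rewrite sim_sym zl eqxx.
    by move=> /(_ skl isT); rewrite orbCA !orbA orbAC -!orbA => /or4P[] ->; rewrite ?orbT.
  move: skl; rewrite aqe 1?eq_sym // => /(merge_inj nab nkl) eqm.
  by rewrite eqm eqxx in neg.
move/eqP: zk => zk; subst k.
have lz: l != z by case/andP: nkl; rewrite eq_sym.
have: sim q w l by rewrite -(sim_transr _ szw).
rewrite aqe // 1?eq_sym // => /(eab _ _ wab).
by rewrite ![l == _]eq_sym => /orP[]->; rewrite ?orbT.
Qed.

Lemma join_exists_discrete : join_exists D.
Proof.
move=> e f nef /neighbor_discrete[a [b [nab ee]]].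
move=> /neighbor_discrete[c [d [ncd ef]]]; subst e f.
rewrite merge_neighbor // nef /= !negb_or => /and4P[ac ad bc bd].
have ab: a != b by case/andP: nab.
have cd: c != d by case/andP: ncd.
have sdq y : sim (merged a b) d y = (d == y).
  by rewrite sim_merge // ![d == _]eq_sym (negPf ad) (negPf bd) !orbF.
have mcd: movable (merged a b) c d by apply: movable_single.
have mab := movable_discrete ncd.
(* The two edges are disjoint and are merged simultaneously. *)
pose q : bell_graph G := move (merged a b) c d.
have qcd: sim q c d by rewrite sim_move_self ?sdq // eq_sym.
have qab: sim q a b by rewrite agree_move ?merge_sim.
exists q; apply/and3P; split.
- apply/andP; split.
    apply/eqP=> eqD; move: qab; rewrite eqD sim_discrete; exact/negP.
  apply/negbT/(@bell_edgeF _ a b c d); last exact/and4P.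
    by rewrite qab sim_discrete (negPf ab).
  by rewrite qcd sim_discrete (negPf cd).
- apply: (@bell_edgeI _ c _ _ c d); first exact: agree_move.
  by rewrite qcd sim_merge // (negPf cd) (negPfC ac) (negPfC bc).
apply: (@bell_edgeI _ a _ _ a b); last first.
  by rewrite qab sim_merge // (negPf ab) (negPf ac) (negPf ad).
by apply: move_mono => //; apply: agree_merge.
Qed.

End Discrete.
(** * Partitions whose neighbourhood looks like that of the discrete one *)

Section Structure.

Variable G : sgraph.
Implicit Types (P Q R q : isp G) (a b c d s t u v w x y z : G).

(** Uniting two singleton parts can be read as moving either vertex. *)
Lemma agree_move_single P v w : nonedge v w -> single P v -> single P w ->
  agree w (move P v w) P.
Proof.
move=> nvw sv sw x y xw yw; rewrite sim_move; last exact: movable_single.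
have [->|xv] := eqVneq x v; have [->|yv] := eqVneq y v => //=.
- by rewrite !sim_refl.
- by rewrite sv sw (negPfC yw) (negPfC yv).
by rewrite sim_sym [RHS]sim_sym sv sw (negPfC xw) (negPfC xv).
Qed.

Lemma agree_move_isol P v w : nonedge v w -> single P w ->
  agree w (move P v w) (isol P v).
Proof.
move=> nvw sw x y xw yw; rewrite sim_move ?sim_isol; last exact: movable_single.
have [->|xv] := eqVneq x v; have [->|yv] := eqVneq y v => //=.
- by rewrite sim_refl.
- by rewrite sw (negPfC yw).
- by rewrite sim_sym sw (negPfC xw) (negPf xv).
by have [->|] := eqVneq x y; rewrite ?sim_refl.
Qed.

Lemma single_isol_other P v w : single P v -> single (isol P w) v.
Proof.
move=> sv y; rewrite sim_isol sv.
by case: (v == y); rewrite ?andbF.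
Qed.

Lemma far_agree P q z : @far (bell_graph G) P q -> agree z q P -> False.
Proof.
case/andP=> /eqP nqP /negP nPq aqP; apply: nPq; apply/bellP; split.
  by move=> ePq; apply: nqP.
by exists z; apply: agree_sym.
Qed.

Lemma farI a b c d P q :
  sim P a b != sim q a b -> sim P c d != sim q c d ->
  [&& a != c, a != d, b != c & b != d] -> @far (bell_graph G) P q.
Proof.
move=> dab dcd abcd; apply/andP; split; last exact/negbT/(bell_edgeF dab dcd).
by apply: contra_neq dab => ->.
Qed.

Lemma isol_neighbor P v w : v != w -> sim P v w -> bell_edge P (isol P v).
Proof.
move=> vw svw; apply: (@bell_edgeI _ v _ _ v w); first exact/agree_sym/agree_isol.
by rewrite svw sim_isol_self (negPf vw).
Qed.

Lemma move_neighbor P v w : movable P v w -> w != v -> ~~ sim P v w ->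
  bell_edge P (move P v w).
Proof.
move=> mvw wv svw; apply: (@bell_edgeI _ v _ _ v w).
  exact/agree_sym/agree_move.
by rewrite (negPf svw) sim_move_self // sim_refl.
Qed.

Variable P : isp G.
Hypothesis uniqP : @join_unique (bell_graph G) P.
Hypothesis cliqueP : @join_clique (bell_graph G) P.
Hypothesis existsP : @join_exists (bell_graph G) P.

(* Otherwise the partitions isolating [a] and [b] respectively have two far
   common neighbours: both isolated, and both isolated then merged. *)
Lemma disjoint_sim_pairs a a' b b' : sim P a a' -> sim P b b' ->
  a != a' -> b != b' -> [&& a != b, a != b', a' != b & a' != b'] ->
  ~~ nonedge a b.
Proof.
move=> sa sb aa bb neq; have /and4P[ab ab' a'b a'b'] := neq.
apply/negP=> nab.
pose e := isol P a; pose f := isol P b.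
pose q := isol e b; pose q' := move q a b.
have sqa : single q a by apply/single_isol_other/single_isol.
have sqb : single q b by apply: single_isol.
have mab : movable q a b by apply: movable_single.
have ea : sim e a a' = false by rewrite sim_isol_self (negPf aa).
have eb : sim e b b' by rewrite agree_isol // eq_sym.
have fa : sim f a a' by rewrite agree_isol.
have fb : sim f b b' = false by rewrite sim_isol_self (negPf bb).
have qa : sim q a a' = false by rewrite sqa (negPf aa).
have qb : sim q b b' = false by rewrite sqb (negPf bb).
have qa' : sim q' a a' = false.
  by rewrite sim_move_self 1?eq_sym // sqb eq_sym (negPf a'b).
have aqe : agree b q e by apply: agree_isol.
have aqf : agree a q f by apply: isol_mono => //; apply: agree_isol.
have aq'a : agree a q' q by apply: agree_move.
have aq'b : agree b q' q by apply: agree_move_single.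
have qb' : sim q' b b' = false by rewrite aq'a // eq_sym.
have qab' : sim q' a b by rewrite sim_move_self ?sim_refl // eq_sym.
suff eqq : q = q' by move: qab'; rewrite -eqq sqa (negPf ab).
apply: (uniqP (e := e) (f := f)).
- by apply/eqP=> eef; move: fa; rewrite -eef ea.
- exact: isol_neighbor aa sa.
- exact: isol_neighbor bb sb.
- apply/and3P; split.
  + by apply: (@farI a a' b b') => //; rewrite ?qa ?qb ?sa ?sb.
  + by apply: (bell_edgeI (x := b) (y := b') aqe); rewrite eb qb.
  by apply: (bell_edgeI (x := a) (y := a') aqf); rewrite fa qa.
apply/and3P; split.
- by apply: (@farI a a' b b') => //; rewrite ?qa' ?qb' ?sa ?sb.
- by apply: (bell_edgeI (x := b) (y := b') (agree_trans aq'b aqe)); rewrite eb qb'.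
by apply: (bell_edgeI (x := a) (y := a') (agree_trans aq'a aqf)); rewrite fa qa'.
Qed.

(** A partner of [v] would form with [v] a pair disjoint from ab, and [disjoint_sim_pairs] would
    forbid the edge av of the complement. *)
Lemma single_outside a b v : sim P a b -> a != b -> ~~ sim P a v ->
  nonedge a v -> single P v.
Proof.
move=> sab ab sav nav y; apply/idP/idP=> [svy|/eqP->]; last exact: sim_refl.
apply: contraTT nav => vy; apply: (disjoint_sim_pairs sab svy) => //.
have nsav x z : sim P a x -> sim P v z -> x != z.
  move=> sax svz; apply: contra sav => /eqP exz; subst z.
  by rewrite (sim_transr _ sax) sim_sym.
by rewrite !nsav ?sim_refl.
Qed.

(** A fourth member [y] would give the disjoint pairs ac and by inside one part, where [a] and [b]
    are nonadjacent in [G]. *)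
Lemma sim_triple a b c y : sim P a b -> sim P a c ->
  [&& a != b, a != c & b != c] -> sim P a y = [|| y == a, y == b | y == c].
Proof.
move=> sab sac /and3P[ab ac bc]; apply/idP/idP; last first.
  by case/or3P=> /eqP->; rewrite ?sim_refl.
move=> say; apply: contraT; rewrite !negb_or => /and3P[ya yb yc].
have sbc : sim P b y by rewrite -(sim_transr _ sab).
have := disjoint_sim_pairs sac sbc ac.
rewrite eq_sym yb ab [a == y]eq_sym ya [c == b]eq_sym bc eq_sym yc.
by rewrite (sim_nonedge sab ab) => /(_ isT isT).
Qed.

(* [b|ac|v], [c|ab|v] and [bc|av] are neighbours of [abc|v], and of [av|b|c]; the
   first two are adjacent but the first and the third are not. *)
Lemma triple_isolated a b c v : sim P a b -> sim P a c ->
  [&& a != b, a != c & b != c] -> ~~ sim P a v -> ~~ nonedge a v.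
Proof.
move=> sab sac abc nsav; have /and3P[ab ac bc] := abc; apply/negP=> nav.
have sv : single P v by apply: single_outside sab ab nsav nav.
have classP y : sim P a y = [|| y == a, y == b | y == c] by apply: sim_triple.
have va : v != a by rewrite eq_sym; case/andP: nav.
have [vb vc] : v != b /\ v != c.
  by split; apply: contraNneq nsav => ->.
pose f := isol P b; pose g := isol P c; pose x := move P a v.
pose q := move f a v.
have mx : movable P a v by apply: movable_single.
have mq : movable f a v by apply: movable_single => //; apply: single_isol_other.
(* Both [f] and [g] separate [b] from [c]; they differ only in which of the two [a] accompanies. *)
have afg : agree a f g.
  move=> y z ya za; rewrite !sim_isol.
  have sby : sim P b y = (y == b) || (y == c).
    by rewrite -(sim_transr _ sab) classP (negPf ya).
  have [->|yz] //= := eqVneq y z.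
  apply/idP/idP=> /and3P[n1 n2 syz]; rewrite syz ?andbT; apply/andP; split.
  - apply/eqP=> eyc; subst y; move: syz.
    by rewrite -(sim_transr _ sac) classP (negPf za) (negPf n2) eq_sym (negPf yz).
  - apply/eqP=> ezc; subst z; move: syz.
    by rewrite sim_sym -(sim_transr _ sac) classP (negPf ya) (negPf n1) (negPf yz).
  - apply/eqP=> eyb; subst y; move: syz.
    by rewrite -(sim_transr _ sab) classP (negPf za) (negPf n2) orbF eq_sym (negPf yz).
  apply/eqP=> ezb; subst z; move: syz.
  by rewrite sim_sym -(sim_transr _ sab) classP (negPf ya) (negPf n1) (negPf yz).
have sbc : sim P b c by rewrite -(sim_transr _ sab).
have fbc : sim f b c = false by rewrite sim_isol_self (negPf bc).
have fav : sim f a v = false by rewrite sim_sym single_isol_other // (negPf va).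
have xav : sim x a v by rewrite sim_move_self // sim_refl.
have qav : sim q a v by rewrite sim_move_self // sim_refl.
have aqf : agree a q f by apply: agree_move.
have qbc : sim q b c = false by rewrite aqf // eq_sym.
have xbc : sim x b c by rewrite agree_move // eq_sym.
have fab : sim f a b = false by rewrite sim_sym sim_isol_self eq_sym (negPf ab).
have gab : sim g a b by rewrite agree_isol.
have nfx : bell_edge f x = false.
  apply: (@bell_edgeF _ a v b c); rewrite ?fav ?xav ?fbc ?xbc //.
  by rewrite ab ac vb vc.
suff : bell_edge f x by rewrite nfx.
have gav : sim g a v = false by rewrite sim_sym single_isol_other // (negPf va).
apply: (cliqueP (f := g) (q := q)).
- by apply/eqP=> efx; move: xav; rewrite -efx fav.
- by apply: isol_neighbor bc _.
- by apply: (@isol_neighbor _ _ a); rewrite 1?eq_sym // sim_sym.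
- exact: move_neighbor.
- apply/and3P; split.
  + apply: (@farI a v b c); rewrite ?(negPf nsav) ?qav ?sbc ?qbc //.
    by rewrite ab ac vb vc.
  + by apply: (bell_edgeI (x := a) (y := v) aqf); rewrite qav fav.
  by apply: (bell_edgeI (x := a) (y := v) (agree_trans aqf afg)); rewrite qav gav.
- apply: (@bell_edgeI _ b _ _ b c); last by rewrite qbc xbc.
  by apply: move_mono => //; [rewrite eq_sym | apply: agree_isol].
by apply: (bell_edgeI (x := a) (y := b) afg); rewrite fab gab.
Qed.

Lemma sim_pair u v w y : sim P u v -> u != v -> ~~ sim P u w -> nonedge u w ->
  sim P u y = (y == u) || (y == v).
Proof.
move=> suv uv nsuw nuw; apply/idP/idP; last first.
  by case/orP=> /eqP->; rewrite ?sim_refl.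
move=> suy; apply: contraT; rewrite negb_or => /andP[yu yv].
have := triple_isolated suv suy _ nsuw; rewrite nuw; apply.
by rewrite uv eq_sym yu eq_sym yv.
Qed.

(* From [uv|w], the neighbours [u|v|w] and [uvw] are not adjacent and have no far
   common neighbour. *)
Lemma pair_no_triangle u v w : sim P u v -> u != v -> ~~ sim P u w ->
  nonedge u w -> ~~ nonedge v w.
Proof.
move=> suv uv nsuw nuw; apply/negP=> nvw.
have sw : single P w by apply: single_outside suv uv nsuw nuw.
have classP y : sim P u y = (y == u) || (y == v) by apply: sim_pair nsuw nuw.
have wu : w != u by rewrite eq_sym; case/andP: nuw.
have wv : w != v by rewrite eq_sym; case/andP: nvw.
have mwu : movable P w u.
  by move=> y yw; rewrite classP => /orP[]/eqP->; rewrite nonedge_sym.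
pose d := isol P u; pose g := move P w u.
have sd r : (r == u) || (r == v) -> single d r.
  case/orP=> /eqP->; first exact: single_isol.
  move=> y; rewrite sim_isol -(sim_transr _ suv) classP.
  by rewrite [v == u]eq_sym uv /=; case: (eqVneq y u) => _ /=; rewrite ?orbF // eq_sym orbb.
(* Splitting a pair can be read as moving either of its ends. *)
have dP r : (r == u) || (r == v) -> agree r d P.
  case/orP=> /eqP->; first exact: agree_isol.
  move=> x y xv yv; rewrite sim_isol.
  have [->|xy] /= := eqVneq x y; first by rewrite sim_refl.
  have [exu|xu] /= := eqVneq x u.
    by rewrite exu classP (negPf yv) -exu (negPfC xy).
  have [->|yu] //= := eqVneq y u.
  by rewrite sim_sym classP (negPf xv) (negPf xu).
have gP : agree w g P by apply: agree_move.
have guv : sim g u v by rewrite gP // eq_sym.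
have gw r : (r == u) || (r == v) -> sim g w r.
  move=> hr; rewrite sim_move_self ?classP //.
  by case/orP: hr => /eqP->; rewrite eq_sym.
have dw r : (r == u) || (r == v) -> sim d w r = false.
  move=> hr; rewrite single_isol_other //.
  by case/orP: hr => /eqP->; apply: negbTE.
have hu : (u == u) || (u == v) by rewrite eqxx.
have hv : (v == u) || (v == v) by rewrite eqxx orbT.
have duv : sim d u v = false by rewrite sd // (negPf uv).
(* A common neighbour changes [d] at [s] and [g] at [t], so every pair on which [d] and [g] differ
   contains [s] or [t]. *)
have cover s t q : agree s q d -> agree t q g -> forall x y,
    sim d x y != sim g x y -> [|| s == x, s == y, t == x | t == y].
  move=> aqd aqg x y; apply: contraNT; rewrite !negb_or => /and4P[sx sy tx ty].
  by rewrite -aqd 1?eq_sym // aqg // eq_sym.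
have /existsP : d != g.
  by apply/eqP=> edg; move: guv; rewrite -edg duv.
case.
- exact: isol_neighbor uv suv.
- by apply: move_neighbor => //; [rewrite eq_sym | rewrite sim_sym].
(* [d] and [g] differ on all three pairs inside {u, v, w}, and no vertex lies in all of them. *)
- apply/negP=> /bellP[_ [z adg]].
  have cov := cover z z d (@agree_refl _ _ _) adg.
  have := cov u v; rewrite duv guv => /(_ isT) /or4P hz.
  have := cov w u; rewrite dw // gw // => /(_ isT).
  have := cov w v; rewrite dw // gw // => /(_ isT).
  have [zw|zw] /= := eqVneq z w.
    by case: hz => /eqP hz; move: wu wv; rewrite -hz zw eqxx.
  rewrite !orbb => /eqP-> /eqP evu; by rewrite evu eqxx in uv.
move=> q /and3P[fq /bellP[_ [s aqd]] /bellP[_ [t aqg]]].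
have cov := cover s t q aqd aqg.
have [hs|] := boolP ((s == u) || (s == v)).
  exact: far_agree fq (agree_trans aqd (dP _ hs)).
rewrite negb_or => /andP[su sv].
have [tw|tw] := eqVneq t w.
  by subst t; apply: far_agree fq (agree_trans aqg gP).
have := cov u v; rewrite duv guv (negPf su) (negPf sv) => /(_ isT) /= ht.
(* As [s] avoids the pair uv, the vertex [t] is one of its ends; [r] is the other one. *)
have [r [hr rt tr]] : exists r, [/\ (r == u) || (r == v), r != t &
    forall y, (y == u) || (y == v) -> y != t -> y = r].
  case/orP: ht => /eqP->.
    exists v; split=> //; first by rewrite eq_sym.
    by move=> y /orP[]/eqP-> //; rewrite eqxx.
  by exists u; split=> // y /orP[]/eqP-> //; rewrite eqxx.
have sr : s != r by case/orP: hr => /eqP->.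
have := cov w r; rewrite dw // gw // (negPf sr) (negPf tw) [t == r]eq_sym (negPf rt).
move=> /(_ isT); rewrite !orbF => /eqP esw; subst s.
have wt : w != t by rewrite eq_sym.
have wr : w != r by case/orP: hr => /eqP->.
have qwr : sim q w r by rewrite aqg // gw.
(* [q] unites [w] with [r] and separates [t] from both, so it is [P] with only [r] moved. *)
apply: (@far_agree _ _ r fq) => x y xr yr.
wlog xw : x y xr yr / x != w.
  move=> W; have [exw|] := eqVneq x w; last exact: W.
  have [eyw|yw] := eqVneq y w; first by rewrite exw eyw !sim_refl.
  by rewrite sim_sym [RHS]sim_sym W.
have [->|yw] := eqVneq y w; last by rewrite aqd ?(dP r hr).
have rw : r != w by rewrite eq_sym.
rewrite sim_sym (sim_transr _ qwr) aqd // (sd r hr).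
by rewrite sim_sym sw (negPfC xr) (negPfC xw).
Qed.

(* If [w'] is single, [uv|w|w'] has the neighbours [uw|v|w'], [u|v|w|w'] and
   [uv|ww'], which violate [join_clique] at [u|v|ww']. Otherwise moving [u] to [w]
   and moving [w'] to [w] are neighbours that violate [join_exists]. *)
Lemma pair_leaf u v w w' : sim P u v -> u != v -> ~~ sim P u w ->
  nonedge u w -> nonedge w w' -> w' = u.
Proof.
move=> suv uv nsuw nuw nww; apply/eqP; apply: contraT => w'u.
have nvw := pair_no_triangle suv uv nsuw nuw.
have w'v : w' != v by apply: contraNneq nvw => <-; rewrite nonedge_sym.
have classP y : sim P u y = (y == u) || (y == v) by apply: sim_pair nsuw nuw.
have sw : single P w by apply: single_outside suv uv nsuw nuw.
have wu : w != u by rewrite eq_sym; case/andP: nuw.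
have wv : w != v by apply: contraNneq nsuw => ->.
have ww : w != w' by case/andP: nww.
pose x := move P u w.
have mx : movable P u w by apply: movable_single.
have xuw : sim x u w by rewrite sim_move_self // sim_refl.
have xuv : sim x u v = false by rewrite sim_move_self 1?eq_sym // sw (negPf wv).
have edgePx : bell_edge P x by apply: move_neighbor.
have nsuw' : ~~ sim P u w' by rewrite classP (negPf w'u) (negPf w'v).
have sww' : sim P w w' = false by rewrite sw (negPf ww).
have uw' : u != w' by rewrite eq_sym.
have vw : v != w by rewrite eq_sym.
have vw' : v != w' by rewrite eq_sym.
have uw : u != w by rewrite eq_sym.
have vu : v != u by rewrite eq_sym.
have w'w : w' != w by rewrite eq_sym.
have [sw'|[z zw' sw'z]] := single_or P w'.
- pose d := isol P u; pose y := move P w w'; pose q := move d w w'.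
  have sdw' : single d w' by apply: single_isol_other.
  have sdw : single d w by apply: single_isol_other.
  have my : movable P w w' by apply: movable_single.
  have mq : movable d w w' by apply: movable_single.
  have adP : agree u d P by apply: agree_isol.
  have aqd : agree w q d by apply: agree_move.
  have axd : agree w x d by apply: agree_move_isol.
  have aqy : agree u q y by apply: move_mono.
  have ayP : agree w y P by apply: agree_move.
  have axP : agree u x P by apply: agree_move.
  have yuv : sim y u v by rewrite ayP.
  have yww' : sim y w w' by rewrite sim_move_self // sim_refl.
  have qww' : sim q w w' by rewrite sim_move_self // sim_refl.
  have duv : sim d u v = false by rewrite sim_isol_self (negPf uv).
  have quv : sim q u v = false by rewrite aqd.
  have quw : sim q u w = false by rewrite sim_sym (sim_transr _ qww') aqd // sdw' (negPf w'u).
  have xww' : sim x w w' = false by rewrite axP.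
  have duw : sim d u w = false by rewrite sim_isol_self (negPf uw).
  have dww' : sim d w w' = false by rewrite sdw (negPf ww).
  have yuw : sim y u w = false.
    by rewrite sim_sym (sim_transr _ yww') ayP // sim_sym (negPf nsuw').
  have disj : [&& u != w, u != w', v != w & v != w'] by rewrite uw uw' vw vw'.
  suff : bell_edge x y.
    by have -> : bell_edge x y = false by apply: bell_edgeF disj; rewrite ?xuv ?yuv ?xww' ?yww'.
  apply: (cliqueP (f := d) (q := q)) => //.
  + by apply/eqP=> exy; move: xuw; rewrite exy yuw.
  + exact: isol_neighbor uv suv.
  + by apply: move_neighbor => //; rewrite sww'.
  + apply/and3P; split.
    * by apply: farI disj; rewrite ?suv ?quv ?sww' ?qww'.
    * apply: (bell_edgeI (x := u) (y := w) (agree_trans aqd (agree_sym axd))).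
      by rewrite quw xuw.
    by apply: (bell_edgeI (x := w) (y := w') aqd); rewrite qww' dww'.
  + by apply: (bell_edgeI (x := u) (y := v) aqy); rewrite quv yuv.
  apply: (bell_edgeI (x := u) (y := w) (agree_trans axP (agree_sym adP))).
  by rewrite xuw duw.
pose y := move P w' w.
have my : movable P w' w by apply: movable_single; rewrite // nonedge_sym.
have ayP : agree w' y P by apply: agree_move.
have axP : agree u x P by apply: agree_move.
have nsuz : ~~ sim P u z.
  by apply: contra nsuw' => suz; rewrite (sim_trans suz) // sim_sym.
have [zu zv] : z != u /\ z != v.
  by split; apply: contraNneq nsuz => ->; rewrite ?sim_refl.
have uz : u != z by rewrite eq_sym.
have vz : v != z by rewrite eq_sym.
have zw : z != w.
  by apply: contraTneq sw'z => ->; rewrite sim_sym sww'.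
have wz : w != z by rewrite eq_sym.
have w'z : w' != z by rewrite eq_sym.
have yuv : sim y u v by rewrite ayP.
have yuw : sim y u w = false by rewrite ayP // (negPf nsuw).
have yww' : sim y w w' by rewrite sim_sym sim_move_self // sim_refl.
have yw'z : sim y w' z = false by rewrite sim_move_self // sw (negPf wz).
have xww' : sim x w w' = false by rewrite axP.
have xw'z : sim x w' z by rewrite axP.
case: (@existsP x y) => //.
- by apply/eqP=> exy; move: xuw; rewrite exy yuw.
- by apply: move_neighbor; rewrite // sim_sym sww'.
- apply/negbT/(@bell_edgeF _ u v w' z); rewrite ?xuv ?yuv ?xw'z ?yw'z //.
  by rewrite uw' uz vw' vz.
move=> q /and3P[fq /bellP[_ [s aqx]] /bellP[_ [t aqy]]].
have cov a b : sim x a b != sim y a b -> [|| s == a, s == b, t == a | t == b].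
  apply: contraNT; rewrite !negb_or => /and4P[sa sb ta tb].
  by rewrite -aqx 1?eq_sym // aqy // eq_sym.
have cuv : [|| s == u, s == v, t == u | t == v] by apply: cov; rewrite xuv yuv.
have cuw : [|| s == u, s == w, t == u | t == w] by apply: cov; rewrite xuw yuw.
have cww : [|| s == w, s == w', t == w | t == w'] by apply: cov; rewrite xww' yww'.
have cwz : [|| s == w', s == z, t == w' | t == z] by apply: cov; rewrite xw'z yw'z.
(* The relations [x] and [y] differ along the path v, u, w, w', z. Its only vertex cover by two
   vertices consists of [u] and [w']. *)
have [[es et]|[es et]] : (s = u /\ t = w') \/ (s = w' /\ t = u).
- have [es|su] := eqVneq s u.
    left; split=> //; move: cww cwz; rewrite es (negPf uw) (negPf uw') (negPf uz) /=.
    by have [//|_] := eqVneq t w'; rewrite orbF => /eqP->; rewrite (negPf wz).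
  have et : t = u.
    move: cuv cuw cwz; rewrite (negPf su) /=; have [//|_] := eqVneq t u.
    case/orP=> /eqP->; first rewrite (negPf vw) /=.
      by move=> /eqP->; rewrite (negPf vw') (negPf vz) (negPf ww) (negPf wz).
    rewrite [v == w](negPf vw) => /orP[/eqP->|//].
    by rewrite (negPf vw') (negPf vz) (negPf ww) (negPf wz).
  right; split=> //; move: cww cwz; rewrite et (negPf uw) (negPf uw') (negPf uz) !orbF.
  by have [//|_] := eqVneq s w'; rewrite orbF => /eqP->; rewrite (negPf wz).
- by subst s; case: (far_agree fq (agree_trans aqx axP)).
subst s t.
(* Now [q] keeps uw from [x] and ww' from [y], so [u] and [w'] are nonadjacent in [G], contrary to
   the disjoint pairs uv and w'z of [P]. *)
have : sim q u w'.
  by apply: (@sim_trans _ _ w); [rewrite aqx | rewrite aqy].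
move/sim_nonedge=> /(_ uw') nuw'.
have := disjoint_sim_pairs suv sw'z uv w'z; rewrite nuw' uw' uz vw' vz.
by move=> /(_ isT).
Qed.

End Structure.
(** * The involution exchanging a part with its singletons *)

Section Toggle.

Variable G : sgraph.
Variable A : {set G}.
Implicit Types (P Q q : isp G) (a b c t u v w x y z : G).

(* [A] is the pair of centres of a double star component of the complement, or a
   triangle component of it: if [A] has a third vertex, [pairA] excludes all
   edges leaving [A]. *)
Hypothesis cliqueA : forall a b, a \in A -> b \in A -> a != b -> nonedge a b.
Hypothesis otherA : forall a, a \in A -> exists2 b, b \in A & b != a.
Hypothesis leafA : forall a w y, a \in A -> w \notin A -> nonedge a w ->
  nonedge w y -> y = a.
Hypothesis pairA : forall a w b c, a \in A -> w \notin A -> nonedge a w ->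
  b \in A -> c \in A -> b != a -> c != a -> b = c.
Hypothesis tripleA : forall a b c d, [&& a \in A, b \in A, c \in A & d \in A] ->
  [&& a != b, a != c & b != c] -> [|| d == a, d == b | d == c].

Definition split_part q :=
  mkisp (fun x y => (x == y) || [&& x \notin A, y \notin A & sim q x y]).

Definition glue_part q :=
  mkisp (fun x y => (x \in A) && (y \in A) || [&& x \notin A, y \notin A & sim q x y]).

Lemma sim_split q x y :
  sim (split_part q) x y = (x == y) || [&& x \notin A, y \notin A & sim q x y].
Proof.
rewrite sim_mk //; split=> [a|a b|b a c|a b].
- by rewrite eqxx.
- by rewrite eq_sym sim_sym; congr orb; rewrite andbCA.
- case/predU1P=> [->//|/and3P[Aa Ab sab]] /predU1P[<-|/and3P[_ Ac sbc]].
    by rewrite Aa Ab sab orbT.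
  by rewrite Aa Ac (sim_trans sab sbc) orbT.
case/predU1P=> [->|/and3P[_ _ sab]]; first by rewrite eqxx.
exact: sim_nonedge sab.
Qed.

Lemma sim_glue q x y : sim (glue_part q) x y =
  (x \in A) && (y \in A) || [&& x \notin A, y \notin A & sim q x y].
Proof.
rewrite sim_mk //; split=> [a|a b|b a c|a b].
- by rewrite sim_refl; case: (a \in A).
- by rewrite sim_sym; case: (a \in A); case: (b \in A).
- case: (a \in A); case: (b \in A); case: (c \in A); rewrite /= ?orbF //.
  exact: sim_trans.
case Aa: (a \in A); case Ab: (b \in A) => //=; first by move=> _; apply: cliqueA.
exact: sim_nonedge.
Qed.

Definition is_part q := [forall a in A, forall y, sim q a y == (y \in A)].
Definition is_split q := [forall a in A, forall y, sim q a y == (a == y)].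

Definition toggle q :=
  if is_part q then split_part q else if is_split q then glue_part q else q.

Lemma is_partP q :
  reflect (forall a y, a \in A -> sim q a y = (y \in A)) (is_part q).
Proof.
apply: (iffP forall_inP) => [H a y Aa|H a Aa]; last by apply/forallP=> y; rewrite H.
by have /forallP/(_ y)/eqP := H a Aa.
Qed.

Lemma is_splitP q :
  reflect (forall a y, a \in A -> sim q a y = (a == y)) (is_split q).
Proof.
apply: (iffP forall_inP) => [H a y Aa|H a Aa]; last by apply/forallP=> y; rewrite H.
by have /forallP/(_ y)/eqP := H a Aa.
Qed.

Hypothesis A_neq0 : exists a, a \in A.

Lemma is_part_split q : is_part q -> is_split q = false.
Proof.
move=> /is_partP pq; apply/negP=> /is_splitP sq.
have [a Aa] := A_neq0; have [b Ab ba] := otherA Aa.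
by have := sq a b Aa; rewrite pq // Ab eq_sym (negPf ba).
Qed.

Lemma toggle_part q : is_part q -> toggle q = split_part q.
Proof. by rewrite /toggle => ->. Qed.

Lemma toggle_split q : is_split q -> toggle q = glue_part q.
Proof.
by rewrite /toggle => sq; case: ifP => [/is_part_split|]; rewrite sq.
Qed.

Lemma toggle_other q : ~~ is_part q -> ~~ is_split q -> toggle q = q.
Proof. by rewrite /toggle => /negPf-> /negPf->. Qed.

Lemma toggleK : involutive toggle.
Proof.
move=> q; have [pq|npq] := boolP (is_part q).
  have sq : is_split (split_part q).
    by apply/is_splitP=> a y Aa; rewrite sim_split Aa orbF.
  rewrite (toggle_part pq) toggle_split //; move/is_partP: pq => pq.
  apply: sim_inj => x y; rewrite sim_glue sim_split.
  have [Ax|Ax] /= := boolP (x \in A); first by rewrite orbF pq.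
  have [Ay|Ay] /= := boolP (y \in A); first by rewrite sim_sym pq // (negPf Ax).
  by case: eqP => // ->; rewrite sim_refl.
have [sq|nsq] := boolP (is_split q); last by rewrite !toggle_other.
have pq : is_part (glue_part q).
  by apply/is_partP=> a y Aa; rewrite sim_glue Aa orbF.
rewrite (toggle_split sq) toggle_part //; move/is_splitP: sq => sq.
apply: sim_inj => x y; rewrite sim_split sim_glue.
have [Ax|Ax] /= := boolP (x \in A); first by rewrite orbF sq.
have [Ay|Ay] /= := boolP (y \in A).
  by rewrite orbF sim_sym sq // eq_sym.
by case: eqP => // ->; rewrite sim_refl.
Qed.

Lemma agree_split z q q' : agree z q q' -> agree z (split_part q) (split_part q').
Proof. by move=> aqq x y xz yz; rewrite !sim_split aqq. Qed.

Lemma agree_glue z q q' : agree z q q' -> agree z (glue_part q) (glue_part q').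
Proof. by move=> aqq x y xz yz; rewrite !sim_glue aqq. Qed.

(** Agreement off [z] leaves at most one vertex of [A] besides [z], so being in the same part [A]
    and being equal coincide there. *)
Lemma agree_split_glue z q q' : agree z q q' -> is_part q -> is_split q' ->
  agree z (split_part q) (glue_part q').
Proof.
move=> aqq /is_partP pq /is_splitP sq x y xz yz.
rewrite sim_split sim_glue aqq //.
have [Ax|Ax] /= := boolP (x \in A); have [Ay|Ay] /= := boolP (y \in A).
- by rewrite orbF -(sq _ _ Ax) -aqq // pq // Ay.
- by rewrite orbF; apply: contraNF Ay => /eqP<-.
- by rewrite orbF; apply: contraNF Ax => /eqP->.
by case: eqP => // ->; rewrite sim_refl.
Qed.

(** [tripleA] bounds [A] by three vertices; they are listed from [z], the vertex that is ignored in
    the comparisons below. *)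
Lemma part_minus z : z \in A ->
  (exists2 b, b != z & forall y, (y \in A) = (y == z) || (y == b)) \/
  (exists b c, [&& b != z, c != z & b != c] /\
     forall y, (y \in A) = [|| y == z, y == b | y == c]).
Proof.
move=> Az; have [b Ab bz] := otherA Az.
case: (pickP [pred c | [&& c \in A, c != z & c != b]]) => [c /and3P[Ac cz cb]|no].
  right; exists b, c; rewrite bz cz [b == c]eq_sym cb; split=> // y.
  apply/idP/idP=> [Ay|/or3P[]/eqP-> //].
  by apply: tripleA; rewrite ?Az ?Ab ?Ac ?Ay // ![z == _]eq_sym bz cz eq_sym.
left; exists b => // y; apply/idP/idP=> [Ay|/orP[]/eqP-> //].
by have := no y; rewrite /= Ay /=; case: (y == z) => //=; case: (y == b).
Qed.

Lemma triple_no_outside z b c a w :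
  z \in A -> (forall y, (y \in A) = [|| y == z, y == b | y == c]) ->
  [&& b != z, c != z & b != c] -> a \in A -> w \notin A -> ~~ nonedge a w.
Proof.
move=> Az defA /and3P[bz cz bc] Aa Aw; apply/negP=> naw.
have Ab : b \in A by rewrite defA eqxx orbT.
have Ac : c \in A by rewrite defA eqxx !orbT.
have bad x y : x \in A -> y \in A -> x != a -> y != a -> x != y -> False.
  by move=> Ax Ay xa ya /eqP[]; apply: pairA Aa Aw naw Ax Ay xa ya.
move: (Aa); rewrite defA => /or3P[]/eqP ea; subst a.
- exact: bad Ab Ac bz cz bc.
- by apply: bad Az Ac _ _ _; rewrite eq_sym // eq_sym.
by apply: bad Az Ab _ _ _; rewrite // eq_sym.
Qed.

(** If [z] were outside [A], it would have joined all of [A] and so have two neighbours in [A] in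
    the complement, against [leafA]. So [z] is in [A]. For a pair [t] is [z]; for a triangle the
    moved vertex changes. *)
Lemma toggle_part_other z q q' : agree z q q' -> is_part q ->
  ~~ is_part q' -> ~~ is_split q' -> exists t, agree t (split_part q) q'.
Proof.
move=> aqq /is_partP pq np' ns'.
have [Az|Az] := boolP (z \in A); last first.
  case/is_partP: np' => a y Aa; have az : a != z by apply: contraNneq Az => <-.
  have [->|yz] := eqVneq y z; last by rewrite -aqq // pq.
  rewrite (negPf Az); apply/negP=> saz; have [b Ab ba] := otherA Aa.
  have bz : b != z by apply: contraNneq Az => <-.
  have sbz : sim q' b z.
    by rewrite -(sim_transr z (_ : sim q' a b)) // -aqq // pq.
  move/eqP: ba; apply; apply: (leafA Aa Az); first exact: sim_nonedge saz az.
  by rewrite nonedge_sym; apply: sim_nonedge sbz bz.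
case: (part_minus Az) => [[b bz defA]|[b [c [bcz defA]]]].
  exists z => x y xz yz; rewrite sim_split -aqq //.
  have Ab : b \in A by rewrite defA eqxx orbT.
  rewrite !defA (negPf xz) (negPf yz) /=.
  have [->|xb] /= := eqVneq x b.
    by rewrite pq // defA (negPf yz) orbF eq_sym.
  have [->|yb] /= := eqVneq y b.
    by rewrite sim_sym pq // defA (negPf xz) (negPf xb).
  by case: eqP => // ->; rewrite sim_refl.
have noA := triple_no_outside Az defA bcz.
have /and3P[bz cz bc] := bcz.
have Ab : b \in A by rewrite defA eqxx orbT.
have Ac : c \in A by rewrite defA eqxx !orbT.
have outA y : y \notin A -> sim q' z y = false.
  move=> Ay; apply: contraNF (noA z y Az Ay) => szy; apply: sim_nonedge szy _.
  by apply: contraNneq Ay => <-.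
have sbc : sim q' b c by rewrite -aqq // pq.
have szb : sim q' z b = false.
  apply: contraNF np' => szb; apply/is_partP=> a y Aa.
  have [->|yz] := eqVneq y z.
    rewrite Az; move: Aa; rewrite defA => /or3P[]/eqP->; rewrite ?sim_refl //.
      by rewrite sim_sym.
    by rewrite sim_sym (sim_trans szb).
  have [->|az] := eqVneq a z; last by rewrite -aqq // pq.
  by rewrite (sim_transr y szb) -aqq // pq.
(* In [q'] the part [A] has become bc and a lone [z], so splitting [A] completely amounts to moving
   [b] out. *)
exists b => x y xb yb; rewrite sim_split.
have szc : sim q' z c = false by rewrite sim_sym -(sim_transr z sbc) sim_sym szb.
wlog: x y xb yb / (y == z) ==> (x == z).
  move=> W; have [yz|yz] := eqVneq y z; last by apply: W => //; rewrite (negPf yz).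
  have [xz|xz] := eqVneq x z; first by apply: W; rewrite // xz eqxx implybT.
  rewrite [RHS]sim_sym -(W y x) // ?(negPf xz) // [y == x]eq_sym.
  by congr orb; rewrite sim_sym andbCA.
have [->|xz] := eqVneq x z.
  rewrite Az /= orbF => _; have [<-|yz] := eqVneq z y; first by rewrite sim_refl.
  have [Ay|/outA->//] := boolP (y \in A).
  move: Ay; rewrite defA (negPfC yz) (negPf yb) /= => /eqP->.
  by rewrite szc.
rewrite implybF => yz; rewrite -aqq //.
have [Ax|Ax] /= := boolP (x \in A).
  rewrite pq // orbF defA (negPf yz) (negPf yb) /=.
  by move: Ax; rewrite defA (negPf xz) (negPf xb) /= => /eqP->; rewrite eq_sym.
have [Ay|Ay] /= := boolP (y \in A).
  by rewrite orbF sim_sym pq // (negPf Ax); apply: contraNF Ax => /eqP->.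
by case: eqP => // ->; rewrite sim_refl.
Qed.

(** Dual to [toggle_part_other], except that [z] may now lie outside [A]: it is then a leaf that has
    joined a vertex of [A]. *)
Lemma toggle_split_other z q q' : agree z q q' -> is_split q ->
  ~~ is_part q' -> ~~ is_split q' -> exists t, agree t (glue_part q) q'.
Proof.
move=> aqq /is_splitP sq np' ns'.
have [Az|Az] := boolP (z \in A); last first.
  have neqz a : a \in A -> a != z by move=> Aa; apply: contraNneq Az => <-.
  have [a Aa saz] : exists2 a, a \in A & sim q' a z.
    apply/exists_inP; apply: contraNT ns' => /exists_inPn no; apply/is_splitP=> a y Aa.
    have [->|yz] := eqVneq y z; last by rewrite -aqq ?sq // neqz.
    by rewrite (negPf (no a Aa)) (negPf (neqz _ Aa)).
  have naz := sim_nonedge saz (neqz _ Aa).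
  have [b Ab ba] := otherA Aa.
  have defA y : (y \in A) = (y == a) || (y == b).
    apply/idP/idP=> [Ay|/orP[]/eqP-> //].
    case: eqVneq => //= ya; apply/eqP; exact: pairA Aa Az naz Ay Ab ya ba.
  have sz y : y != a -> sim q' z y = (z == y).
    move=> ya; apply/idP/idP=> [szy|/eqP->]; last exact: sim_refl.
    apply: contraNT ya => /(sim_nonedge szy) nzy.
    by apply/eqP; apply: leafA Aa Az naz nzy.
  have sqz y : y != a -> sim q z y = (z == y).
    have [<-|yz] := eqVneq z y; first by rewrite sim_refl.
    move=> ya; apply: contraNF ya => szy; apply/eqP.
    by apply: leafA Aa Az naz _; apply: sim_nonedge szy _.
  (* By [pairA], [A] is the pair ab. In [q'] the vertex [a] sits with its leaf [z], in [glue_part q]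
     it sits with [b]; only [a] moves. *)
  exists a => x y xa ya; rewrite sim_glue !defA (negPf xa) (negPf ya) /=.
  have sb w : w != a -> sim q' b w = (b == w).
    move=> wa; have [->|wz] := eqVneq w z; last by rewrite -aqq // ?sq // neqz.
    by rewrite sim_sym sz // eq_sym.
  have [->|xb] /= := eqVneq x b; first by rewrite sb // orbF eq_sym.
  have [->|yb] /= := eqVneq y b.
    by rewrite sim_sym sb // eq_sym (negPf xb).
  have [->|xz] := eqVneq x z; first by rewrite sz // sqz.
  have [->|yz] := eqVneq y z; first by rewrite sim_sym [RHS]sim_sym sz // sqz.
  exact: aqq.
case: (part_minus Az) => [[b bz defA]|[b [c [bcz defA]]]].
  exists z => x y xz yz; rewrite sim_glue -aqq //.
  have Ab : b \in A by rewrite defA eqxx orbT.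
  rewrite !defA (negPf xz) (negPf yz) /=.
  have [->|xb] /= := eqVneq x b; first by rewrite sq // orbF eq_sym.
  by have [->|yb] //= := eqVneq y b; rewrite sim_sym sq // eq_sym (negPf xb).
have noA := triple_no_outside Az defA bcz.
have outA y : y \notin A -> sim q' z y = false.
  move=> Ay; apply: contraNF (noA z y Az Ay) => szy; apply: sim_nonedge szy _.
  by apply: contraNneq Ay => <-.
wlog szb : b c bcz defA noA / sim q' z b.
  move=> W; have [szb|nszb] := boolP (sim q' z b); first exact: (W b c).
  have [szc|nszc] := boolP (sim q' z c).
    have /and3P[bz cz bc] := bcz.
    apply: (W c b) => //; first by rewrite cz bz eq_sym.
    by move=> y; rewrite defA; congr orb; rewrite orbC.
  case/is_splitP: ns' => a y Aa.
  have sz x : sim q' z x = (z == x).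
    have [<-|xz] := eqVneq z x; first exact: sim_refl.
    have [Ax|/outA //] := boolP (x \in A).
    move: Ax; rewrite defA (negPfC xz) /= => /orP[]/eqP->; exact: negbTE.
  have [->|yz] := eqVneq y z; first by rewrite sim_sym sz eq_sym.
  by have [->|az] := eqVneq a z; rewrite ?sz // -aqq // sq.
have /and3P[bz cz bc] := bcz.
have Ab : b \in A by rewrite defA eqxx orbT.
(* In [q'] the triangle is cut into zb and [c], so gluing it moves [c] in. *)
exists c => x y xc yc; rewrite sim_glue.
have sz y0 : y0 != c -> sim q' z y0 = (y0 \in A).
  move=> yc0; have [Ay|/outA //] := boolP (y0 \in A).
  by move: Ay; rewrite defA (negPf yc0) orbF => /orP[]/eqP->; rewrite ?sim_refl.
have [Ax|Ax] /= := boolP (x \in A).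
  rewrite orbF -sz //; move: Ax; rewrite defA (negPf xc) orbF.
  by case/orP=> /eqP-> //; rewrite (sim_transr y szb).
have [Ay|Ay] /= := boolP (y \in A).
  rewrite sim_sym; move: Ay; rewrite defA (negPf yc) orbF.
  case/orP=> /eqP->; first by rewrite outA.
  by rewrite -(sim_transr x szb) outA.
by rewrite aqq //; [apply: contraNneq Ax | apply: contraNneq Ay] => ->.
Qed.

(** Adjacency survives the exchange, but the moved vertex may differ from [z]. *)
Lemma toggle_agree z q q' : agree z q q' -> exists t, agree t (toggle q) (toggle q').
Proof.
move=> aqq; have aqq' := agree_sym aqq.
have flip (p p' : isp G) : (exists t, agree t p p') -> exists t, agree t p' p.
  by case=> t app; exists t; apply: agree_sym.
have [pq|pq] := boolP (is_part q); first rewrite (toggle_part pq).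
  have [pq'|pq'] := boolP (is_part q').
    by rewrite toggle_part //; exists z; apply: agree_split.
  have [sq'|sq'] := boolP (is_split q').
    by rewrite toggle_split //; exists z; apply: agree_split_glue.
  by rewrite toggle_other //; apply: toggle_part_other aqq _ _ _.
have [sq|sq] := boolP (is_split q); first rewrite (toggle_split sq).
  have [pq'|pq'] := boolP (is_part q').
    by rewrite toggle_part //; exists z; apply/agree_sym/agree_split_glue.
  have [sq'|sq'] := boolP (is_split q').
    by rewrite toggle_split //; exists z; apply: agree_glue.
  by rewrite toggle_other //; apply: toggle_split_other aqq _ _ _.
rewrite (toggle_other pq sq).
have [pq'|pq'] := boolP (is_part q').
  by rewrite toggle_part //; apply/flip/(toggle_part_other aqq').
have [sq'|sq'] := boolP (is_split q').
  by rewrite toggle_split //; apply/flip/(toggle_split_other aqq').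
by rewrite toggle_other //; exists z.
Qed.

Lemma toggle_edge q q' : bell_edge (toggle q) (toggle q') = bell_edge q q'.
Proof.
have half p p' : bell_edge p p' -> bell_edge (toggle p) (toggle p').
  case/bellP=> npp [z /toggle_agree app]; apply/bellP; split=> //.
  by move/(can_inj toggleK).
by apply/idP/idP=> [/half|/half //]; rewrite !toggleK.
Qed.

End Toggle.
(** * Reconstruction from the edges at the discrete partition *)

(* A bijection compatible with the stars is chosen fibrewise: the two ends of an
   isolated edge of the complement have the same star. *)
Lemma fiber_injection (T1 T2 : finType) (S : eqType) (g1 : T1 -> S) (g2 : T2 -> S) :
  (forall s, #|[pred x | g1 x == s]| <= #|[pred y | g2 y == s]|) ->
  exists2 F : T1 -> T2, injective F & forall x, g2 (F x) = g1 x.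
Proof.
move=> le12.
pose E1 s := enum [pred x | g1 x == s]; pose E2 s := enum [pred y | g2 y == s].
have in1 x : x \in E1 (g1 x) by rewrite mem_enum inE.
have [x|F FP] := @fin_all_exists _ (fun=> T2)
    (fun x y => g2 y = g1 x /\ index y (E2 (g1 x)) = index x (E1 (g1 x))).
  have lt : index x (E1 (g1 x)) < size (E2 (g1 x)).
    by rewrite -cardE; apply: leq_trans (le12 _); rewrite cardE index_mem.
  (* A default value for [nth]; the fibre is nonempty because the index is below its size. *)
  have [y0 _] : exists y0, y0 \in E2 (g1 x).
    by case: (E2 _) lt => // y s _; exists y; rewrite inE eqxx.
  exists (nth y0 (E2 (g1 x)) (index x (E1 (g1 x)))); split.
    by have := mem_nth y0 lt; rewrite mem_enum inE => /eqP.
  by rewrite index_uniq ?enum_uniq.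
exists F => [x x' eqF|x]; last by have [] := FP x.
have [ex ix] := FP x; have [ex' ix'] := FP x'.
have eg : g1 x = g1 x' by rewrite -ex -ex' eqF.
apply: (index_inj x (in1 x)); first by rewrite eg in1.
by rewrite /= -ix eqF eg ix'.
Qed.

(** * Stars of the complement as sets of neighbours of the discrete partition *)

Section Star.

Variable G : sgraph.
Implicit Types (e f g q : bell_graph G) (a b c d u v w x y z : G).

Local Notation D := (discrete G : bell_graph G).

Definition star v : {set bell_graph G} :=
  [set e : bell_graph G | edge D e && [exists w, (w != v) && sim e v w]].

Lemma mem_star v a b : nonedge a b ->
  (merged a b \in star v) = (v == a) || (v == b).
Proof.
move=> nab; rewrite inE edge_merge //=; have /andP[ab _] := nab.
apply/existsP/orP=> [[w /andP[wv]]|[]/eqP->].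
- rewrite sim_merge // (negPfC wv) /=.
  by case/orP=> /andP[-> _]; [left | right].
- by exists b; rewrite eq_sym ab merge_sim.
by exists a; rewrite ab sim_sym merge_sim.
Qed.

Lemma starP e v :
  reflect (exists2 w, nonedge v w & e = merged v w) (e \in star v).
Proof.
apply: (iffP idP) => [ev|[w nvw ->]]; last by rewrite mem_star ?eqxx.
have /neighbor_discrete[a [b [nab ee]]]: edge D e by move: ev; rewrite inE => /andP[].
move: ev; rewrite ee mem_star // => /orP[]/eqP->; first by exists b.
by exists a; rewrite 1?nonedge_sym // mergeC.
Qed.

Lemma star_edge e v : e \in star v -> edge D e.
Proof. by rewrite inE => /andP[]. Qed.

Lemma star_two v w e f : e != f -> e \in star v -> f \in star v ->
  e \in star w -> f \in star w -> v = w.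
Proof.
move=> nef /starP[b nvb ee] /starP[c nvc ef]; subst e f.
rewrite !mem_star // => /orP[]/eqP-> // /orP[]/eqP ebc //.
by rewrite ebc eqxx in nef.
Qed.

(** An edge common to the stars of two distinct vertices joins them. Thus the family of stars
    determines the complement. *)
Lemma star_meet u v : u != v -> nonedge u v = (star u :&: star v != set0).
Proof.
move=> uv; apply/idP/set0Pn=> [nuv|[e /setIP[/starP[w nuw ->]]]].
  by exists (merged u v); rewrite inE !mem_star // !eqxx orbT.
by rewrite mem_star // eq_sym (negPf uv) => /eqP->.
Qed.

Lemma star_neighbor e f v : e != f -> e \in star v -> f \in star v -> edge e f.
Proof.
move=> nef /starP[b nvb ee] /starP[c nvc ef]; subst e f.
by rewrite merge_neighbor // nef eqxx.
Qed.

Lemma neighbor_star a b e : nonedge a b -> edge D e -> edge (merged a b) e ->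
  e != merged a b /\ ((e \in star a) || (e \in star b)).
Proof.
move=> nab /neighbor_discrete[c [d [ncd ->]]]; rewrite merge_neighbor // eq_sym.
case/andP=> -> h; split=> //.
by rewrite !mem_star // -orbA.
Qed.

(** Passing from [q] to the merge of vb moves a single vertex, which must be [c] and also [d], as
    [q] unites both with [v]. *)
Lemma star_no_join v e f g q : e != f -> e != g -> f != g ->
  e \in star v -> f \in star v -> g \in star v -> joins D q e f -> edge q g = false.
Proof.
move=> nef neg nfg /starP[b nvb ee] /starP[c nvc ef] /starP[d nvd eg].
subst e f g; case/and3P=> fq qe qf; apply/negP=> qg.
have [svb [z [zv zb aqe _]]] := far_neighbor fq nvb qe.
have [svc _] := far_neighbor fq nvc qf.
have [svd _] := far_neighbor fq nvd qg.
have via x : nonedge v x -> merged v b != merged v x -> sim q v x -> z = x.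
  move=> nvx nex svx; apply/eqP; apply: contra_neqT nex => zx.
  by apply: merge_inj => //; rewrite -aqe // eq_sym.
by move: nfg; rewrite -(via c) // -(via d) // eqxx.
Qed.

Lemma triangle_join a b c : nonedge a b -> nonedge a c -> nonedge b c ->
  exists q, joins D q (merged a b) (merged a c) /\ edge q (merged b c).
Proof.
move=> nab nac nbc; pose S := [set a; b; c].
have ab : a != b by case/andP: nab.
have ac : a != c by case/andP: nac.
have bc : b != c by case/andP: nbc.
have nS x y : x \in S -> y \in S -> x != y -> nonedge x y.
  by rewrite !inE -!orbA => /or3P[] /eqP-> /or3P[] /eqP->; rewrite ?eqxx // nonedge_sym.
pose q : bell_graph G := mkisp (fun x y => (x == y) || (x \in S) && (y \in S)).
have sq x y : sim q x y = (x == y) || (x \in S) && (y \in S).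
  rewrite sim_mk //; split=> [s|s t|t s r|s t].
  - by rewrite eqxx.
  - by rewrite eq_sym andbC.
  - case/predU1P=> [->//|/andP[Ss St]] /predU1P[<-|/andP[_ Sr]].
      by rewrite Ss St orbT.
    by rewrite Ss Sr orbT.
  by case/predU1P=> [->|/andP[Ss St] //]; [rewrite eqxx | apply: nS].
(* Taking [z] out of the triangle part leaves the merge of the other two vertices. *)
have edge_q x y z : nonedge x y -> z != x -> z != y ->
    (forall w, (w \in S) = [|| w == x, w == y | w == z]) -> edge q (merged x y).
  move=> nxy zx zy defS; have /andP[xy _] := nxy.
  apply: (@bell_edgeI _ z _ _ z x); last first.
    by rewrite sq sim_merge // (negPf zx) (negPf zy) !defS !eqxx !orbT.
  move=> s t sz tz; rewrite sq sim_merge // !defS (negPf sz) (negPf tz) !orbF.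
  have [->|sx] := eqVneq s x; have [->|tx] := eqVneq t x; rewrite ?eqxx //=.
    by rewrite andbF orbF.
  have [->|//] := eqVneq s y.
  by rewrite andbF orbF [t == y]eq_sym orbb.
exists q; split; last first.
  by apply: (edge_q b c a) => // w; rewrite !inE -!orbA orbC -!orbA.
apply/and3P; split.
- have sS x y : x \in S -> y \in S -> x != y -> sim D x y != sim q x y.
    by move=> Sx Sy /negPf xy; rewrite sim_discrete sq xy Sx Sy.
  have [Sa Sb Sc] : [/\ a \in S, b \in S & c \in S] by rewrite !inE !eqxx !orbT.
  apply/andP; split.
    by apply/eqP=> eqD; have := sS a b Sa Sb ab; rewrite eqD eqxx.
  apply/negP=> /bellP[_ [z aDq]].
  have out x y : x \in S -> y \in S -> x != y -> (x == z) || (y == z).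
    move=> Sx Sy xy; apply: contraNT (sS x y Sx Sy xy).
    by rewrite negb_or => /andP[xz yz]; rewrite aDq.
  have := out _ _ Sa Sb ab; have := out _ _ Sa Sc ac; have := out _ _ Sb Sc bc.
  have [eaz|az] /= := eqVneq a z; first by rewrite -eaz ![_ == a]eq_sym (negPf ab) (negPf ac).
  by move=> _ /eqP<-; rewrite (negPf bc).
- by apply: (edge_q a b c) => //; [rewrite eq_sym | rewrite eq_sym | move=> w; rewrite !inE -!orbA].
apply: (edge_q a c b) => //; [by rewrite eq_sym | move=> w; rewrite !inE -!orbA].
by congr orb; rewrite orbC.
Qed.

(** Pairwise meeting edges form a star or a triangle. If ab and ac are present, an edge avoiding [a]
    must be bc, and [triangle_join] then contradicts the last hypothesis on [K]. *)
Lemma star_of_clique (K : {set bell_graph G}) e f : e != f -> e \in K -> f \in K ->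
  {in K, forall g, edge D g} ->
  {in K &, forall g h, g != h -> edge g h} ->
  {in K & &, forall g h k, [&& g != h, g != k & h != k] ->
     forall q, joins D q g h -> edge q k = false} ->
  exists v, {in K, forall g, g \in star v}.
Proof.
move=> nef Ke Kf KD KE Kj.
have /neighbor_discrete[a [b [nab ee]]] := KD e Ke.
wlog fa : a b nab ee / f \in star a.
  move=> W; have := KE e f Ke Kf nef; rewrite ee.
  case/(neighbor_star nab (KD f Kf)) => _ /orP[]; first exact: (W a b).
  by move=> fb; apply: (W b a) fb; [rewrite nonedge_sym | rewrite ee mergeC].
have /starP[c nac ef] := fa; exists a => g Kg; subst e f.
have [->|nge] := eqVneq g (merged a b); first by rewrite mem_star // eqxx.
have [->|ngf] := eqVneq g (merged a c); first by rewrite mem_star // eqxx.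
have eg : edge (merged a b) g := KE _ _ Ke Kg (negbT (negPfC nge)).
have fg : edge (merged a c) g := KE _ _ Kf Kg (negbT (negPfC ngf)).
have [_ /orP[//|gb]] := neighbor_star nab (KD g Kg) eg.
have [_ /orP[//|gc]] := neighbor_star nac (KD g Kg) fg.
case/starP: gb => d nbd egd; move: gc; rewrite egd mem_star // => /orP[]/eqP ec.
  by rewrite ec eqxx in nef.
subst d; have [q [jq qg]] := triangle_join nab nac nbd; rewrite -egd in qg.
have neq3 : [&& merged a b != merged a c, merged a b != g & merged a c != g].
  by apply/and3P; split; [exact: nef | rewrite eq_sym; exact: nge | rewrite eq_sym; exact: ngf].
by rewrite (Kj _ _ _ Ke Kf Kg neq3 q jq) in qg.
Qed.

End Star.

(** * Images of stars under an isomorphism matching the discrete partitions *)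

Section StarImage.

Variables G1 G2 : sgraph.
Variables (f : bell_graph G1 -> bell_graph G2) (g : bell_graph G2 -> bell_graph G1).
Hypotheses (fK : cancel f g) (gK : cancel g f).
Hypothesis fE : forall x y, edge (f x) (f y) = edge x y.
Hypothesis fD : f (discrete G1) = discrete G2.

Let f_inj := can_inj fK.

Lemma star_image_sub v e e' : e != e' -> e \in star v -> e' \in star v ->
  exists v', f @: star v \subset star v'.
Proof.
move=> nee ev ev'.
have [] := @star_of_clique G2 (f @: star v) (f e) (f e').
- by rewrite (inj_eq f_inj).
- exact: imset_f.
- exact: imset_f.
- by move=> _ /imsetP[x xv ->]; rewrite -fD fE (star_edge xv).
- move=> _ _ /imsetP[x xv ->] /imsetP[y yv ->].
  by rewrite (inj_eq f_inj) fE => nxy; apply: star_neighbor yv.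
- move=> _ _ _ /imsetP[x xv ->] /imsetP[y yv ->] /imsetP[z zv ->].
  rewrite !(inj_eq f_inj) => /and3P[nxy nxz nyz] q; rewrite -(gK q).
  move: (g q) => p; rewrite fE /joins /far -fD (inj_eq f_inj) !fE.
  exact: star_no_join zv.
by move=> v' Kv'; exists v'; apply/subsetP.
Qed.

End StarImage.

Section StarFibers.

Variables G1 G2 : sgraph.
Variables (f : bell_graph G1 -> bell_graph G2) (g : bell_graph G2 -> bell_graph G1).
Hypotheses (fK : cancel f g) (gK : cancel g f).
Hypothesis fE : forall x y, edge (f x) (f y) = edge x y.
Hypothesis fD : f (discrete G1) = discrete G2.
Hypothesis nonisolated1 : forall v : G1, exists w, nonedge v w.

Let f_inj := can_inj fK.

Let gE x y : edge (g x) (g y) = edge x y.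
Proof. by rewrite -fE !gK. Qed.

Let gD : g (discrete G2) = discrete G1.
Proof. by rewrite -fD fK. Qed.

(** Apply [star_image_sub] to [f] and then to its inverse: the composite inclusion ends in a star
    sharing two edges with [star v], hence in [star v] itself. *)
Lemma star_image v e e' : e != e' -> e \in star v -> e' \in star v ->
  exists v', f @: star v = star v'.
Proof.
move=> nee ev ev'; have [v' sub] := star_image_sub fK gK fE fD nee ev ev'.
have fev : f e \in star v' by apply: (subsetP sub); apply: imset_f.
have fev' : f e' \in star v' by apply: (subsetP sub); apply: imset_f.
have nfe : f e != f e' by rewrite (inj_eq f_inj).
have [v2 sub2] := star_image_sub gK fK gE gD nfe fev fev'.
have back x : x \in star v' -> g x \in star v2.
  by move=> xv; apply: (subsetP sub2); apply: imset_f.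
have ev2 : v = v2.
  by apply: (star_two nee) => //; [rewrite -(fK e) | rewrite -(fK e')]; apply: back.
exists v'; apply/eqP; rewrite eqEsubset sub; apply/subsetP=> x xv'.
by rewrite -(gK x) imset_f // ev2 back.
Qed.

(** A star with two edges has one vertex and its image is a star. A one-edge star belongs to a leaf,
    or to both ends of an isolated edge; in each case the image edge has at least as many such
    ends. *)
Lemma star_fiber_le (s : {set bell_graph G2}) :
  #|[pred v | f @: star v == s]| <= #|[pred v | star v == s]|.
Proof.
case: (pickP [pred v | f @: star v == s]) => [v /= /eqP<-{s}|no]; last first.
  by rewrite eq_card0.
have eq_star u : (f @: star u == f @: star v) = (star u == star v).
  by apply/eqP/eqP=> [/(imset_inj f_inj)|->].
rewrite (eq_card (_ : _ =i [pred u | star u == star v])); last first.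
  by move=> u; rewrite !inE eq_star.
have [w nvw] := nonisolated1 v; pose e := merged v w.
have ev : e \in star v by apply/starP; exists w.
have ew : e \in star w by rewrite mem_star // eqxx orbT.
have eD : edge (discrete G1 : bell_graph G1) e := star_edge ev.
case: (pickP [pred x in star v | x != e]) => [e' /andP[/= ev' nee]|no].
  have [v' ->] := star_image nee ev' ev.
  have: 0 < #|[pred u | star u == star v']|.
    by apply/card_gt0P; exists v'; rewrite inE /=.
  apply: leq_trans; apply/card_le1P=> u.
  rewrite inE => /eqP eu u'; rewrite !inE; apply/eqP/eqP=> [eu'|-> //].
  by apply: (star_two nee); rewrite ?eu ?eu'.
have sv : star v = [set e].
  apply/setP=> x; rewrite inE; have [->|xe] := eqVneq x e; first exact: ev.
  by have := no x; rewrite /= xe andbT.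
have fiber u : star u = star v -> (u == v) || (u == w).
  by move=> eu; rewrite -(mem_star u nvw) eu.
have feD : edge (discrete G2 : bell_graph G2) (f e) by rewrite -fD fE.
have [v' [w' [nvw' efe]]] := neighbor_discrete feD.
rewrite sv imset_set1.
(* Another edge at an end of [f e] pulls back to an edge meeting [e]; it meets it at [w], since [e]
   is the only edge at [v]. *)
have inw a b x : nonedge a b -> f e = merged a b -> x \in star a -> x != f e ->
    g x \in star w.
  move=> nab eab xa xfe; have ea : f e \in star a by apply/starP; exists b.
  have: edge e (g x) by rewrite -(fK e) gE; apply: star_neighbor ea xa; rewrite eq_sym.
  have gxD : edge (discrete G1 : bell_graph G1) (g x) by rewrite -gD gE (star_edge xa).
  by case/(neighbor_star nvw gxD)=> gxe /orP[|//]; rewrite sv inE (negPf gxe).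
have is_single a b : nonedge a b -> f e = merged a b ->
    (forall x, x \in star a -> x = f e) -> star a = [set f e].
  move=> nab eab ha; apply/setP=> x; rewrite inE; apply/idP/eqP=> [/ha //|->].
  by apply/starP; exists b.
have nwv' : nonedge w' v' by rewrite nonedge_sym.
have efe' : f e = merged w' v' by rewrite efe mergeC.
case: (pickP [pred x in star w | x != e]) => [e' /andP[/= e'w nee]|no']; last first.
  have sfe a b : nonedge a b -> f e = merged a b -> star a = [set f e].
    move=> nab eab; apply: (is_single _ b) => // x xa; apply/eqP.
    apply: contraT => xfe; have := no' (g x); rewrite /= (inw a b) //=.
    by rewrite -(inj_eq f_inj) gK xfe.
  apply: (@leq_trans #|[set v; w]|).
    apply: subset_leq_card; apply/subsetP=> u; rewrite !inE -sv => /eqP; exact: fiber.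
  apply: (@leq_trans #|[set v'; w']|).
    have vw : v != w by case/andP: nvw.
    have vw' : v' != w' by case/andP: nvw'.
    by rewrite !cards2 vw vw'.
  apply: subset_leq_card; apply/subsetP=> u; rewrite !inE => /orP[]/eqP->.
    by rewrite (sfe v' w').
  by rewrite (sfe w' v').
have [x imw] := star_image nee e'w ew.
(* When [star w] is mapped onto the star of one end of [f e], a second edge at the other end would
   lie in both stars along with [f e], against [star_two]. *)
have pos a b : nonedge a b -> f e = merged a b -> x = b -> star a = [set f e].
  move=> nab eab exb; apply: (is_single _ b) => // y ya; apply/eqP.
  apply: contraT => yfe; have gyw := inw a b y nab eab ya yfe.
  have yb : y \in star b by rewrite -exb -imw -(gK y) imset_f.
  have ea : f e \in star a by apply/starP; exists b.
  have eb : f e \in star b by rewrite eab mem_star // eqxx orbT.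
  by have /andP[/eqP[]] := nab; apply: star_two yfe ya ea yb eb.
apply: (@leq_trans 1).
  apply/card_le1P=> u; rewrite inE -sv => /eqP eu u'; rewrite !inE.
  have notw a : star a = star v -> a = v.
    move=> ea; have /orP[/eqP //|/eqP eaw] := fiber a ea.
    by move: e'w; rewrite -eaw ea sv inE (negPf nee).
  apply/eqP/eqP=> [eu'|-> //]; by rewrite (notw u) // (notw u').
apply/card_gt0P.
have : f e \in star x by rewrite -imw imset_f.
rewrite efe mem_star // -efe => /orP[]/eqP ex.
  by exists w'; rewrite inE (pos w' v').
by exists v'; rewrite inE (pos v' w').
Qed.

End StarFibers.

(** Fibrewise injections in both directions make [F] bijective. As [F] carries stars to images of
    stars and [f] preserves intersections, [star_meet] shows that it preserves the complement. *)
Lemma rebuild (G1 G2 : sgraph) (f : bell_graph G1 -> bell_graph G2) :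
  (forall v : G1, exists w, nonedge v w) -> (forall v : G2, exists w, nonedge v w) ->
  bijective f -> (forall x y, edge (f x) (f y) = edge x y) ->
  f (discrete G1) = discrete G2 -> isomorphic G1 G2.
Proof.
move=> no1 no2 [g fK gK] fE fD.
have gE x y : edge (g x) (g y) = edge x y by rewrite -fE !gK.
have gD : g (discrete G2) = discrete G1 by rewrite -fD fK.
have [F Finj FE] := fiber_injection (star_fiber_le fK gK fE fD no1).
have [F' F'inj _] := fiber_injection (star_fiber_le gK fK gE gD no2).
have Fne x y : x != y -> nonedge (F x) (F y) = nonedge x y.
  move=> xy; rewrite !star_meet ?(inj_eq Finj) // !FE -imsetI; last first.
    by move=> e e' _ _; apply: (can_inj fK).
  by rewrite imset_eq0.
exists F; split; first by apply: inj_card_bij => //; apply: leq_card F'inj.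
move=> x y; rewrite !nonedgeE (inj_eq Finj).
by have [->|xy] //= := eqVneq x y; rewrite Fne.
Qed.
(** * The reconstruction theorem *)

Lemma locally_discrete_iso (B B' : sgraph) (f : B -> B') p :
  bijective f -> (forall x y, edge (f x) (f y) = edge x y) ->
  locally_discrete p -> locally_discrete (f p).
Proof.
move=> [g fK gK] fE [pU pC pJ]; have f_inj := can_inj fK.
have jE q e e' : joins (f p) (f q) (f e) (f e') = joins p q e e'.
  by rewrite /joins /far (inj_eq f_inj) !fE.
have img (Q : B' -> Prop) : (forall x, Q (f x)) -> forall y, Q y.
  by move=> Qf y; rewrite -(gK y).
split.
- elim/img=> e; elim/img=> e'; elim/img=> q; elim/img=> q'.
  rewrite (inj_eq f_inj) !fE !jE => *; congr f; exact: (pU e e').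
- elim/img=> e; elim/img=> e'; elim/img=> h; elim/img=> q.
  by rewrite (inj_eq f_inj) !fE !jE; apply: pC.
elim/img=> e; elim/img=> e'; rewrite (inj_eq f_inj) !fE => nee pe pe' ne.
by have [q jq] := pJ e e' nee pe pe' ne; exists (f q); rewrite jE.
Qed.

Lemma locally_discrete_discrete (G : sgraph) :
  @locally_discrete (bell_graph G) (discrete G).
Proof.
split; [exact: join_unique_discrete | exact: join_clique_discrete |].
exact: join_exists_discrete.
Qed.

Lemma nonuniversal_nonedge (G : sgraph) (v : G) :
  ~~ universal v -> exists w, nonedge v w.
Proof.
move=> nuv; case: (pickP (nonedge v)) => [w nvw|no]; first by exists w.
case/negP: nuv; rewrite /universal /degree.
have -> : [set w | edge v w] = [set~ v].
  by apply/setP=> w; rewrite !inE nonedgeE no andbT eq_sym.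
by rewrite cardsC1 subn1.
Qed.

(** The automorphism is [toggle] at the part of [u]. The structural lemmas on locally discrete
    partitions supply the hypotheses on that part. *)
Lemma split_automorphism (G : sgraph) (P : isp G) u v :
  @locally_discrete (bell_graph G) P -> u != v -> sim P u v ->
  exists t : bell_graph G -> bell_graph G,
    [/\ involutive t, forall q q', edge (t q) (t q') = edge q q',
        forall x y, sim (t P) x y -> sim P x y & ~~ sim (t P) u v].
Proof.
move=> [pU pC pJ] uv suv; pose A := [set y | sim P u y].
have simA a y : a \in A -> sim P a y = (y \in A).
  by rewrite [_ \in A]inE [y \in A]inE => sua; rewrite (sim_transr _ sua).
have clA a b : a \in A -> b \in A -> a != b -> nonedge a b.
  by move=> Aa Ab; apply: (@sim_nonedge _ P); rewrite simA.
have otA a : a \in A -> exists2 b, b \in A & b != a.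
  move=> Aa; have [->|au] := eqVneq a u; first by exists v; rewrite ?inE // eq_sym.
  by exists u; rewrite ?inE ?sim_refl // eq_sym.
have lfA a w y : a \in A -> w \notin A -> nonedge a w -> nonedge w y -> y = a.
  move=> Aa Aw naw nwy; have [b Ab ba] := otA a Aa.
  apply: (pair_leaf pU pC pJ (u := a) (v := b) (w := w)) => //.
  - by rewrite simA.
  - by rewrite eq_sym.
  by rewrite simA.
have prA a w b c : a \in A -> w \notin A -> nonedge a w ->
    b \in A -> c \in A -> b != a -> c != a -> b = c.
  move=> Aa Aw naw Ab Ac ba ca; apply/eqP; apply: contraT => bc.
  have := triple_isolated pU pC (a := a) (b := b) (c := c) (v := w).
  by rewrite !simA // naw ![a == _]eq_sym ba ca bc Ab Ac Aw => /(_ isT isT isT isT).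
have trA a b c d : [&& a \in A, b \in A, c \in A & d \in A] ->
    [&& a != b, a != c & b != c] -> [|| d == a, d == b | d == c].
  case/and4P=> Aa Ab Ac Ad abc.
  by rewrite -(sim_triple pU (a := a)) ?simA.
have A0 : exists a, a \in A by exists u; rewrite inE sim_refl.
have pP : is_part A P by apply/is_partP.
exists (toggle A : bell_graph G -> bell_graph G); split.
- exact: toggleK.
- exact: toggle_edge.
- move=> x y; rewrite toggle_part // sim_split.
  by case/predU1P=> [->|/and3P[]//]; apply: sim_refl.
by rewrite toggle_part // sim_split (negPf uv) !inE sim_refl.
Qed.

(** Induction on the number of ordered pairs related by the image of the discrete partition: as long
    as two distinct vertices are united, composing with [split_automorphism] lowers it. *)
Lemma iso_to_discrete (G1 G2 : sgraph) (f : bell_graph G1 -> bell_graph G2) :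
  bijective f -> (forall x y, edge (f x) (f y) = edge x y) ->
  exists f' : bell_graph G1 -> bell_graph G2,
    [/\ bijective f', forall x y, edge (f' x) (f' y) = edge x y
      & f' (discrete G1) = discrete G2].
Proof.
pose m (P : isp G2) := #|[set xy : G2 * G2 | sim P xy.1 xy.2]|.
have [n] := ubnP (m (f (discrete G1))); elim: n f => // n IHn f lemn fb fE.
set P := f (discrete G1) in lemn *.
case: (pickP [pred xy : G2 * G2 | (xy.1 != xy.2) && sim P xy.1 xy.2]) => [[u v]|no].
  case/andP=> /= uv suv.
  have ldP := locally_discrete_iso fb fE (locally_discrete_discrete G1).
  have [t [tK tE subt nuv]] := split_automorphism ldP uv suv.
  apply: (IHn (t \o f)) => [||x y]; last exact: etrans (tE _ _) (fE x y).
  - apply: leq_trans (_ : _ < m P) _; last by rewrite -ltnS.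
    apply: proper_card; apply/properP; split.
      by apply/subsetP=> xy; rewrite !inE; apply: subt.
    by exists (u, v); rewrite inE.
  by apply: bij_comp fb; exists t.
exists f; split=> //; apply: sim_inj => x y; rewrite sim_discrete.
have := no (x, y) => /=; have [->|] //= := eqVneq x y; by rewrite sim_refl.
Qed.

Theorem theorem1p1 (G1 G2 : sgraph)
    (nouniv1 : forall v : G1, ~~ universal v)
    (nouniv2 : forall v : G2, ~~ universal v)
    (bell_iso : isomorphic (bell_graph G1) (bell_graph G2)) :
  isomorphic G1 G2.
Proof.
have [f [fb fE]] := bell_iso.
have [f' [fb' fE' fD']] := iso_to_discrete fb fE.
apply: rebuild fb' fE' fD' => v; exact: nonuniversal_nonedge.
Qed.
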